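(* Let $V$ be a complex Banach space and $H$ a complex Hilbert space with $V\subset H$ (as a linear subspace) and $\|v\|_V\ge\|v\|_H$ for all $v\in V$. Let $T\in(0,\infty)$ and $p\in[1,\infty)$. Let $v_t$, $t\in[0,T]$, be a $V$-valued strongly (Lebesgue) measurable function, and let $v^*_t$, $t\in[0,T]$, be a $V^*$-valued function such that: (i) for every $v\in V$, $\langle v^*_t,v\rangle$ is a measurable function of $t\in[0,T]$; (ii) there is a measurable function $f_t$ on $[0,T]$ such that $\|v^*_t\|_{V^*}\le f_t$ for $t\in[0,T]$; (iii) there is a constant $N_0\in[1,\infty)$ such that, if $p>1$, $$\int_0^T\big(\|v_t\|_V^p+f_t^{p'}\big)\,dt\le N_0,\qquad p'=p/(p-1),$$ and, if $p=1$, $$\int_0^T\|v_r\|_V\,dr+f_t\le N_0\quad\text{for almost every } t\in[0,T].$$ Suppose that $V$ is dense in $H$ (in the metric of $H$) and that $u\in H$ is such that for every $v\in V$ $$(v_t,v)_H=(u,v)_H+\int_0^t\langle v^*_r,v\rangle\,dr$$ for almost all $t\in[0,T]$. Then for every $v\in V$, for almost all $s,t\in[0,T]$, $$(v_t,v)_H-(v_s,v)_H=\int_s^t\langle v^*_r,v\rangle\,dr,$$ and there exists an $H$-valued $H$-strongly continuous function $u_t$, $t\in[0,T]$, such that $u_t=v_t$ for almost all $t\in[0,T]$, $u_0=u$, for all $t\in[0,T]$ and $v\in V$ $$(u_t,v)_H=(u_0,v)_H+\int_0^t\langle v^*_s,v\rangle\,ds,$$ and for all $t\in[0,T]$ $$\|u_t\|_H^2=\|u_0\|_H^2+2\int_0^t\Re\langle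 v^*_s,u_s\rangle\,ds.$$
   Context: $(\cdot,\cdot)_H$ is the scalar product of $H$, linear in the first argument and conjugate-linear in the second. $V^*$ is the dual space of $V$, and $\langle v^*,v\rangle$ ($v^*\in V^*$, $v\in V$) is the pairing, which is linear in $v^*$ and conjugate-linear in $v$ (i.e. elements of $V^*$ act as bounded conjugate-linear functionals on $V$), with $|\langle v^*,v\rangle|\le\|v^*\|_{V^*}\|v\|_V$. $V$ is not assumed reflexive or separable. Measurability and ''almost all'' refer to Lebesgue measure; ''for almost all $s,t\in[0,T]$'' means for almost all $(s,t)\in[0,T]^2$, and exceptional sets may depend on $v$. $\int_s^t=-\int_t^s$ if $s>t$. Since $u_s=v_s\in V$ for almost all $s$, the expression $\langle v^*_s,u_s\rangle$ is defined for almost all $s$. *)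

(* Defs.v *)
From HB Require Import structures.
From mathcomp Require Import all_boot all_order all_algebra complex.
From mathcomp Require Import all_classical all_reals all_analysis.
Import Order.TTheory GRing.Theory Num.Theory.
Import numFieldNormedType.Exports.

Set Implicit Arguments.
Unset Strict Implicit.
Unset Printing Implicit Defensive.

Local Open Scope classical_set_scope.
Local Open Scope complex_scope.
Local Open Scope ring_scope.

(* The real line with the sigma-algebra of all Lebesgue measurable sets, where
   measurableTypeR R only has the Borel sets. It is convertible to R, so
   functions and subsets of R are used on it as they are. *)
Definition lebesgue_line (R : realType) :=
  caratheodory_type ((wlength (idfun : R -> R))^*)%mu.

Notation leb R := (@completed_lebesgue_measure R).

(* The norm of a normed module over R[i] takes its values in R[i]. *)
Definition rnorm (R : realType) (V : normedModType R[i]) (x : V) : R :=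
  complex.Re `|x|.

Definition lebesgue_measurable (R : realType) (D : set R) (f : R -> R) :=
  @measurable_fun _ _ (lebesgue_line R) R D f.

Definition clebesgue_measurable (R : realType) (D : set R) (f : R -> R[i]) :=
  lebesgue_measurable D (fun t => complex.Re (f t)) /\
  lebesgue_measurable D (fun t => complex.Im (f t)).

Definition strongly_measurable (R : realType) (V : normedModType R[i])
    (D : set R) (f : R -> V) :=
  exists2 s : nat -> {fimfun R >-> V},
    forall n x, (measurable : set (set (lebesgue_line R)))
                  (D `&` (s n @^-1` [set x])) &
    {ae leb R, forall t, D t -> (fun n => s n t) @ \oo --> f t}.

(* [cintegral a b f] is oriented: it is minus the integral over [b, a] when
   b < a. *)
Definition cintegral (R : realType) (a b : R) (f : R -> R[i]) : R[i] :=
  let I (D : set R) : R[i] :=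
    (\int[leb R]_(t in D) complex.Re (f t)) +i*
    (\int[leb R]_(t in D) complex.Im (f t)) in
  if a <= b then I `[a, b]%classic else - I `[b, a]%classic.

(* Bounded conjugate-linear functionals. *)
Record dual (R : realType) (V : normedModType R[i]) := Dual {
  dual_fun :> {linear V -> R[i] | (Num.conj : R[i] -> R[i]) \; *%R};
  dual_bounded :
    exists M : R, forall x, complex.Re `|dual_fun x| <= M * rnorm x }.

Definition dual_norm (R : realType) (V : normedModType R[i]) (f : dual V) : R :=
  sup [set complex.Re `|f x| | x in [set x | rnorm x <= 1]].

(* The pairing <f, h> for h in H, where V is seen inside H through j. It only
   makes sense for h in the range of j; elsewhere the value is f 0 = 0. *)
Definition pairing_in (R : realType) (V H : normedModType R[i]) (j : V -> H)
    (f : dual V) (h : H) : R[i] :=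
  f ('pinv_(fun=> 0) [set: V] j h).

(* Main.v *)
Require Import Defs.
From HB Require Import structures.
From mathcomp Require Import all_boot all_order all_algebra complex.
From mathcomp Require Import all_classical all_reals all_analysis.
From mathcomp Require Import ring lra measurable_realfun.
Import Order.TTheory GRing.Theory Num.Theory.
Import numFieldNormedType.Exports.
Local Open Scope classical_set_scope.
Local Open Scope complex_scope.
Local Open Scope ring_scope.

(** The time derivative of [v] is only known weakly, so the energy
    [||v_t||_H^2] has to be computed from increments. Set [k = 1 + f] and let
    [m] be the measure [k dt] on [[0, T]]. Then [|<vs_t, w>| <= k t * ||w||_V],
    and Young's inequality puts [v] in [L^1(m; V)] for every exponent [p]
    ([norms_integrable]).

    _Good times._ The space [V] may be nonseparable, but the values of [v] lie
    a.e. in the closure of the countable set [X] of values of its simple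
    approximations. Let [G] be the set of times [t] at which the weak equation
    holds for all test vectors in [X] and [v_t] is in the closure of [X]; it has
    full measure. By continuity in the test vector,
    [(v_t - v_s, v_r)_H = \int_s^t <vs, v_r>] for [s], [t], [r] in [G], hence
    with [phi t = ||v_t||_H^2],
    [phi t - phi s = Re \int_s^t <vs, v_t> + Re \int_s^t <vs, v_s>].

    _Energy equality on_ [G]. Fix [x] in [V]. The function
    [F t = phi t - 2 \int_0^t Re <vs, x>] satisfies
    [|F t - F s| <= m([s, t]) (||v_t - x|| + ||v_s - x||)]. Cut [[a, b]] into
    [n] cells of equal mass, choose in each cell a point of [G] at which
    [||v - x||] does not exceed its mean, and add up the increments: in the
    limit, [|F b - F a| <= 4 \int_a^b ||v - x|| dm] ([increment_chaining]).
    Therefore [E t = phi t - 2 \int_0^t Re <vs, v>] satisfies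
    [|E b - E a| <= 6 \int_a^b ||v - x|| dm] for every [x] and all
    [a <= b] in [G]. Bounds of this kind can be combined pointwise: if [e1] and
    [e2] both bound the increments over all segments, so does their minimum
    ([increment_le_min]). As [x] runs through [X] these minima tend to [0] a.e.,
    so [E] is constant on [G] ([increment_eq0], [energy_increment]).

    _Continuity._ For [s], [t] in [G],
    [||v_t - v_s||_H^2 <= |phi t - phi s| + 2 m([s, t]) ||v_s||_V]. Near every
    [t0] there is, again by comparison with the mean, some [s] in [G] with
    [m([s, t0]) ||v_s||_V] as small as desired. So [v] is Cauchy along [G] at
    every time and extends to a continuous [u] with values in [H]
    ([cauchy_of_energy]). The weak equation, now for every test vector, and the
    energy equality pass to the limit. At time [0] the weak equation and the
    density of [V] in [H] give [u_0 = u]. *)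

Set Implicit Arguments.
Unset Strict Implicit.
Unset Printing Implicit Defensive.

(** * Integrals over a general measure space *)

Section general_measure.
Context d (T : measurableType d) (R : realType) (mu : {measure set T -> \bar R}).

(** [max f g] lies above [f] everywhere and equals [g] a.e., which reduces the
    comparison of signed functions to the pointwise one. *)
Lemma ae_le_Rintegral (D : set T) (f g : T -> R) : measurable D ->
  mu.-integrable D (EFin \o f) -> mu.-integrable D (EFin \o g) ->
  {ae mu, forall x, D x -> f x <= g x} ->
  \int[mu]_(x in D) f x <= \int[mu]_(x in D) g x.
Proof.
move=> mD fi gi fg.
pose h x := Num.max (f x) (g x).
have mf : measurable_fun D f by exact/measurable_EFinP/(measurable_int mu).
have mg : measurable_fun D g by exact/measurable_EFinP/(measurable_int mu).
have mh : measurable_fun D h by exact: measurable_maxr.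
have hi : mu.-integrable D (EFin \o h).
  apply: (@le_integrable _ _ _ mu D mD _ (EFin \o (fun x => `|f x| + `|g x|))).
  - exact/measurable_EFinP.
  - move=> x Dx /=; rewrite lee_fin /h [leRHS]ger0_norm ?addr_ge0//.
    by rewrite maxEle; case: ifP => _; rewrite ?lerDr ?lerDl.
  - exact: (integrableD mD (integrable_norm fi) (integrable_norm gi)).
rewrite [leRHS](_ : _ = \int[mu]_(x in D) h x).
  by apply: le_Rintegral => // x _; rewrite /h le_max lexx.
congr fine; apply: ae_eq_integral => //; try exact/measurable_EFinP.
by apply: filterS fg => x H Dx; rewrite /h max_r// H.
Qed.

(** Dominated convergence: [min g n] increases to [g]. *)
Lemma integral_truncation_small (D : set T) (g : T -> R) (e : R) :
  measurable D -> mu.-integrable D (EFin \o g) -> (forall x, D x -> 0 <= g x) ->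
  0 < e ->
  exists n : nat, \int[mu]_(x in D) (g x - Num.min (g x) n%:R) < e.
Proof.
move=> mD gi g0 e0.
have mg : measurable_fun D g by exact/measurable_EFinP/(measurable_int mu).
have := @dominated_cvg _ _ _ mu D mD
  (fun n x => (g x - Num.min (g x) n%:R)%:E) (cst 0%:E) (EFin \o g).
have mmin n : measurable_fun D (fun x => Num.min (g x) n%:R).
  exact: measurable_minr.
have : forall x, D x -> (g x - Num.min (g x) n%:R)%:E @[n --> \oo] --> 0%:E.
  move=> x Dx; apply: cvg_near_cst.
  near=> n; rewrite min_l ?subrr//.
  near: n; exists (Num.bound (g x)) => //= n/=.
  by rewrite -(ler_nat R); apply: le_trans; apply/ltW/archi_boundP/g0.
move=> /[swap] /[apply].
have : forall n, measurable_fun D (fun x => (g x - Num.min (g x) n%:R)%:E).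
  by move=> n; apply/measurable_EFinP; exact: measurable_funB.
move=> /[swap] /[apply] /(_ (fun _ _ => isT) gi).
have : forall n x, D x -> (`|(g x - Num.min (g x) n%:R)%:E| <= (g x)%:E)%E.
  move=> n x Dx; rewrite /= lee_fin ger0_norm; last first.
    by rewrite subr_ge0 ge_min lexx.
  by rewrite lerBlDr lerDl le_min g0//=.
move=> /[swap] /[apply].
rewrite integral0 => /fine_cvgP[_] /(@cvgrPdist_lt _ R^o) /(_ _ e0)[n _] /(_ n).
move=> /= /(_ (leqnn _)); rewrite sub0r normrN ger0_norm; last first.
  apply: fine_ge0; apply: integral_ge0 => x Dx.
  by rewrite lee_fin subr_ge0 ge_min lexx.
by exists n.
Unshelve. all: by end_near. Qed.

(** Absolute continuity of the integral: on a set [A] the bounded part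
    [min g n] contributes at most [n * mu A], and the rest is small. *)
Lemma integral_abs_cont (D : set T) (g : T -> R) (e : R) :
  measurable D -> mu.-integrable D (EFin \o g) -> (forall x, D x -> 0 <= g x) ->
  0 < e ->
  exists2 dl : R, 0 < dl & forall A, measurable A -> A `<=` D ->
    (mu A < dl%:E)%E -> \int[mu]_(x in A) g x < e.
Proof.
move=> mD gi g0 e0.
have e20 : 0 < e / 2 by lra.
have [n hn] := integral_truncation_small mD gi g0 e20.
exists (e / 2 / n.+1%:R); first by rewrite divr_gt0.
move=> A mA AD muA.
have gAi : mu.-integrable A (EFin \o g) by exact: integrableS gi.
have mg : measurable_fun D g by exact/measurable_EFinP/(measurable_int mu).
have mini : mu.-integrable D (EFin \o (fun x => Num.min (g x) n%:R)).
  apply: (le_integrable mD _ _ gi).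
    by apply/measurable_EFinP; exact: measurable_minr.
  move=> x Dx /=; rewrite lee_fin !ger0_norm ?g0 ?le_min ?g0//=.
  by rewrite ge_min lexx.
have difi : mu.-integrable D (EFin \o (fun x => g x - Num.min (g x) n%:R)).
  exact: (integrableB mD gi mini).
have finA : (mu A < +oo)%E by rewrite (lt_trans muA)// ltry.
have csti : mu.-integrable A (EFin \o (fun=> n%:R)).
  by apply: measurable_bounded_integrable => //; exact: bounded_cst.
have dif0 x : 0 <= g x - Num.min (g x) n%:R by rewrite subr_ge0 ge_min lexx.
have step : \int[mu]_(x in A) (g x - Num.min (g x) n%:R) < e / 2.
  apply: le_lt_trans hn; rewrite /Rintegral fine_le//.
  - exact: (integrable_fin_num mA (integrableS mD mA AD difi)).
  - exact: (integrable_fin_num mD difi).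
  - apply: ge0_subset_integral => //.
    + exact: (measurable_int mu).
    + by move=> x _; rewrite lee_fin.
rewrite (le_lt_trans (y := \int[mu]_(x in A) ((g x - Num.min (g x) n%:R) + n%:R)))//.
  apply: le_Rintegral => //.
    exact: (integrableD mA (integrableS mD mA AD difi) csti).
  by move=> x _; rewrite -addrA lerDl addrC subr_ge0 ge_min lexx orbT.
rewrite RintegralD//; last exact: (integrableS mD mA AD difi).
rewrite Rintegral_cst// [e]splitr ltr_leD//.
have fA : mu A \is a fin_num by rewrite ge0_fin_numE.
move: muA; rewrite -(fineK fA) lte_fin ltr_pdivlMr// mulrC => /ltW; apply: le_trans.
by rewrite ler_wpM2r ?fine_ge0// ler_nat.
Qed.

End general_measure.

(** * The completed Lebesgue measure *)

Section lebesgue_line.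
Context {R : realType}.
Local Notation lmeasurable := (measurable : set (set (lebesgue_line R))).
Implicit Types A : set R.
Local Notation mu := (leb R).

Lemma lmeas_borel A : (measurable : set (set R)) A -> lmeasurable A.
Proof. exact: sub_caratheodory. Qed.

Lemma lmeas_itv (i : interval R) : lmeasurable [set` i].
Proof. by apply: lmeas_borel; exact: measurable_itv. Qed.

Lemma lmeas_open A : open A -> lmeasurable A.
Proof. by move=> oA; apply: lmeas_borel; exact: open_measurable. Qed.

Lemma leb_itv (a b : R) : a <= b -> mu `[a, b]%classic = (b - a)%:E.
Proof.
move=> ab; rewrite -[LHS]/(@lebesgue_measure R `[a, b]%classic).
rewrite lebesgue_measure_itv/= lte_fin.
by case: ltP => // ba; have -> : a = b by [apply/eqP; rewrite eq_le ab]; rewrite subrr.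
Qed.

Lemma leb_set1 (a : R) : mu [set a] = 0%E.
Proof. exact: lebesgue_measure_set1. Qed.

(** On its sigma-algebra the completed measure is the outer measure generated by
    the intervals, so open supersets approximate Lebesgue measurable sets just
    as they do Borel sets. *)
Lemma leb_outer_regular A (e : R) : lmeasurable A ->
  (mu A < +oo)%E -> 0 < e ->
  exists U, [/\ open U, A `<=` U & (mu (U `\` A) < e%:E)%E].
Proof.
move=> mA Aoo e0; have e20 : 0 < e / 2 by lra.
have [U [oU AU UA]] := outer_measure_open_le A e20.
exists U; split => //.
have mU := lmeas_open oU.
have fA : mu A \is a fin_num by rewrite ge0_fin_numE.
have UA' : (mu U <= mu A + (e / 2)%:E)%E by exact: UA.
rewrite measureD//=; last first.
  by apply: (le_lt_trans UA'); rewrite -(fineK fA) -EFinD ltry.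
rewrite setIidr// lteBlDl//; apply: (le_lt_trans UA').
by rewrite lteD2lE// lte_fin; lra.
Qed.
End lebesgue_line.

(** Almost-everywhere statements quantify over [R], which is only convertible to
    the carrier of the completed measure; the filter structure has to be given
    for that form. *)
#[local] Instance ae_leb_filter (R : realType) :
  Filter (nbhs (almost_everywhere (leb R))).
Proof. exact: (ae_filter_ringOfSetsType (@completed_lebesgue_measure R)). Qed.

(** * Integrals over segments *)

Section segment_integrals.
Context {R : realType}.
Local Notation lmeasurable := (measurable : set (set (lebesgue_line R))).
Implicit Types (a b c x y : R) (g : R -> R).
Local Notation mu := (leb R).
Local Notation segint g a b := (\int[mu]_(x in `[a, b]%classic) g x).
Local Notation segintegrable g a b := (mu.-integrable `[a, b]%classic (EFin \o g)).

Lemma subset_segment a b x y : a <= x -> y <= b ->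
  `[x, y]%classic `<=` `[a, b]%classic.
Proof.
move=> ax yb t /=; rewrite !in_itv/= => /andP[xt ty].
by rewrite (le_trans ax xt) (le_trans ty yb).
Qed.

Lemma segintegrable_sub g a b x y : segintegrable g a b -> a <= x -> y <= b -> segintegrable g x y.
Proof.
move=> gi ax yb; apply: integrableS gi; [exact: lmeas_itv..|].
exact: subset_segment.
Qed.

Lemma segint_point g a : segint g a a = 0.
Proof.
have ma : lmeasurable [set a].
  by rewrite -set_itv1; exact: lmeas_itv.
have mg : @measurable_fun _ _ (lebesgue_line R) _ [set a] (EFin \o g).
  exact: measurable_fun_set1.
rewrite set_itv1 /Rintegral (ae_eq_integral (cst 0%E)) ?integral0//.
by apply: ae_eq0 => //; exact: leb_set1.
Qed.

Lemma segint_split g a b c : a <= b -> b <= c -> segintegrable g a c ->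
  segint g a c = segint g a b + segint g b c.
Proof.
move=> ab bc gi.
have mb : lmeasurable [set b].
  by rewrite -set_itv1; exact: lmeas_itv.
have E1 : `[a, c]%classic = `[a, b]%classic `|` `]b, c]%classic.
  by rewrite -itv_bndbnd_setU// bnd_simp.
have E2 : `[b, c]%classic = [set b] `|` `]b, c]%classic.
  by rewrite -set_itv1 -itv_bndbnd_setU// bnd_simp.
have D1 : [disjoint `[a, b]%classic & `]b, c]%classic].
  by apply/disj_setPS => y [] /=; rewrite !in_itv/= => /andP[_ yb] /andP[]; rewrite ltNge yb.
have D2 : [disjoint [set b] & `]b, c]%classic].
  by apply/disj_setPS => y [] /= ->; rewrite in_itv/= ltxx.
have gi2 := segintegrable_sub gi ab (lexx c).
rewrite E1 Rintegral_setU//; [|exact: lmeas_itv..|by rewrite -E1].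
congr (_ + _); rewrite E2 Rintegral_setU//; [|exact: lmeas_itv|by rewrite -E2].
by have := segint_point g b; rewrite set_itv1 => ->; rewrite add0r.
Qed.

Lemma segint_ge0 g a b : (forall x, a <= x <= b -> 0 <= g x) -> 0 <= segint g a b.
Proof. by move=> g0; apply: Rintegral_ge0 => x /=; rewrite in_itv/=; exact: g0. Qed.

Lemma segint_le g h a b : segintegrable g a b -> segintegrable h a b ->
  (forall x, a <= x <= b -> g x <= h x) -> segint g a b <= segint h a b.
Proof.
move=> gi hi gh; apply: le_Rintegral => //; exact: lmeas_itv.
Qed.

Lemma segint_norm_le g h a b : segintegrable g a b -> segintegrable h a b ->
  (forall x, a <= x <= b -> `|g x| <= h x) -> `|segint g a b| <= segint h a b.
Proof.
move=> gi hi gh; apply: (le_trans (le_normr_Rintegral _ gi)); first exact: lmeas_itv.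
by apply: segint_le => //; exact: integrable_norm.
Qed.

Lemma segint_mono g a b x y : segintegrable g a b -> (forall t, a <= t <= b -> 0 <= g t) ->
  a <= x -> x <= y -> y <= b -> segint g x y <= segint g a b.
Proof.
move=> gi g0 ax xy yb; have xb := le_trans xy yb.
rewrite (segint_split ax xb gi) (segint_split xy yb) ?(segintegrable_sub gi)//.
have h1 : 0 <= segint g a x.
  by apply: segint_ge0 => t /andP[at_ tx]; rewrite g0// at_ (le_trans tx).
have h2 : 0 <= segint g y b.
  by apply: segint_ge0 => t /andP[yt tb]; rewrite g0// tb (le_trans _ yt)// (le_trans ax).
lra.
Qed.

Lemma segint_unif_cont g a b e : segintegrable g a b -> 0 < e ->
  exists2 dl : R, 0 < dl & forall x y, a <= x -> x <= y -> y <= b ->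
    y - x < dl -> segint (fun t => `|g t|) x y < e.
Proof.
move=> gi e0.
have := integral_abs_cont (lmeas_itv `[a, b]) (integrable_norm gi) (fun x _ => normr_ge0 (g x)) e0.
move=> [dl dl0 H]; exists dl => // x y ax xy yb yx; apply: H.
- exact: lmeas_itv.
- exact: subset_segment.
- by rewrite /= leb_itv// lte_fin.
Qed.

Lemma segint_cont_modulus g a b e : segintegrable g a b -> 0 < e ->
  exists2 dl : R, 0 < dl & forall x y, a <= x <= b -> a <= y <= b ->
    `|x - y| < dl -> `|segint g a x - segint g a y| < e.
Proof.
move=> gi e0; have [dl dl0 H] := segint_unif_cont gi e0; exists dl => //.
move=> x y /andP[ax xb] /andP[ay yb].
wlog xy : x y ax xb ay yb / x <= y.
  move=> W; have [/W|/ltW/W] := leP x y; first exact.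
  by rewrite (distrC x) (distrC (segint g a x)); exact.
rewrite (distrC x) (@ger0_norm _ (y - x)) ?subr_ge0// => xydl.
rewrite (segint_split ax xy) ?(segintegrable_sub gi)// opprD addrA subrr sub0r normrN.
have gxy := segintegrable_sub gi ax yb.
apply: le_lt_trans (H _ _ ax xy yb xydl).
by apply: segint_norm_le => //; exact: integrable_norm.
Qed.

Lemma segint_continuous g a b : segintegrable g a b ->
  {within `[a, b], continuous (fun t => segint g a t)}.
Proof.
move=> gi; apply/subspace_continuousP => x /=; rewrite in_itv/= => xab.
apply/(@cvgrPdist_lt _ R^o) => e e0.
have [dl dl0 H] := segint_cont_modulus gi e0.
rewrite near_withinE/=; apply/nbhs_ballP; exists dl => //= y xy.
by rewrite in_itv/= => yab; apply: H.
Qed.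
End segment_integrals.

(** * Bounding increments by chaining *)

Section chaining.
Context {R : realType}.
Implicit Types (a b c x y : R) (g k e : R -> R) (G : set R).
Local Notation mu := (leb R).
Local Notation segint g a b := (\int[mu]_(x in `[a, b]%classic) g x).
Local Notation segintegrable g a b := (mu.-integrable `[a, b]%classic (EFin \o g)).

Lemma ae_subsegment G a b x y : {ae mu, forall t, a <= t <= b -> G t} ->
  a <= x -> y <= b -> {ae mu, forall t, x <= t <= y -> G t}.
Proof.
move=> HG ax yb; apply: filterS HG => t H /andP[xt ty]; apply: H.
by rewrite (le_trans ax xt) (le_trans ty yb).
Qed.

(** A function cannot exceed its mean, here for the weight [k], at almost every
    point. The slack [h] makes the argument a strict comparison of integrals
    even if [e] is a.e. equal to its mean. *)
Lemma pick_below_mean G k e x y (h : R) :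
  segintegrable k x y -> segintegrable (fun t => e t * k t) x y ->
  (forall t, x <= t <= y -> 0 <= k t) ->
  {ae mu, forall t, x <= t <= y -> G t} -> 0 < segint k x y -> 0 < h ->
  exists t, [/\ x <= t <= y, G t &
    segint k x y * e t <= segint (fun t => e t * k t) x y + h].
Proof.
move=> ki eki k0 HG J0 h0; apply: contrapT => H.
set c := (segint (fun t => e t * k t) x y + h) / segint k x y.
have cl : {ae mu, forall t, `[x, y]%classic t -> c * k t <= e t * k t}.
  apply: filterS HG => t Gt /=; rewrite in_itv/= => xty.
  rewrite ler_wpM2r ?k0// leNgt; apply/negP => ec; apply: H; exists t; split => //.
    exact: Gt.
  by rewrite mulrC -ler_pdivlMr//; exact: ltW.
have cki : segintegrable (fun t => c * k t) x y by exact: (integrableZl (lmeas_itv _) c ki).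
have := ae_le_Rintegral (lmeas_itv _) cki eki cl.
rewrite RintegralZl//; last exact: lmeas_itv.
by rewrite /c divfK ?gt_eqF//; move: h0; clear; lra.
Qed.

(** An increment of [F] over a segment is controlled by the values of [e] at the
    end points only, and these may be large. The segment is cut into cells of
    equal [k dt]-mass [d]; between points chosen in consecutive cells the mass
    is at most [2 d], and [d * e t] at a point chosen below the mean is bounded
    by the integral of [e] over its cell. Each such point occurs in two
    increments, which gives the constant 4; the end points [a] and [b]
    contribute [O(d)]. *)
Lemma increment_chaining G k e (F : R -> R) a b : a <= b -> G a -> G b ->
  segintegrable k a b -> segintegrable (fun t => e t * k t) a b ->
  (forall t, a <= t <= b -> 0 <= k t) -> (forall t, 0 <= e t) ->
  {ae mu, forall t, a <= t <= b -> G t} ->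
  (forall s t, G s -> G t -> a <= s -> s <= t -> t <= b ->
    `|F t - F s| <= segint k s t * (e s + e t)) ->
  `|F b - F a| <= 4 * segint (fun t => e t * k t) a b.
Proof.
move=> ab Ga Gb ki eki k0 e0 HG HF.
set m := segint k a b; set W := segint (fun t => e t * k t) a b.
have W0 : 0 <= W by apply: segint_ge0 => t tab; rewrite mulr_ge0// k0.
have [m0|m0] := eqVneq m 0.
  have := HF a b Ga Gb (lexx _) ab (lexx _); rewrite -/m m0 mul0r => /le_trans; apply.
  by rewrite mulr_ge0.
have {}m0 : 0 < m by rewrite lt_neqAle eq_sym m0; apply: segint_ge0.
(* The error term, of order [1 / n], comes from the two end points and from the
   slacks [d * d] in the choice of the [n.+1] intermediate points. *)
suff H : forall n : nat, `|F b - F a| <=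
    4 * W + (m * (2 * e a + e b + 4 * m)) / n.+1%:R.
  apply/ler_addgt0Pr => h h0.
  set C := m * (2 * e a + e b + 4 * m) in H.
  have C0 : 0 <= C by rewrite mulr_ge0 ?(ltW m0)// !addr_ge0 ?mulr_ge0// ltW.
  apply: (le_trans (H (Num.truncn (C / h)))).
  rewrite lerD2l ler_pdivrMr// mulrC -ler_pdivrMr//.
  by rewrite ltW// truncnS_gt.
move=> n; set d := m / n.+1%:R.
have d0 : 0 < d by rewrite divr_gt0.
have nd : n.+1%:R * d = m by rewrite /d mulrC divfK.
(* [tau] is the end of the [i]-th cell and [t] the point chosen in it. The
   term [2 * d * e t] sets aside the share of [t] in the next increment. *)
have step : forall i, (i <= n.+1)%N -> exists tau t,
    [/\ a <= t, t <= tau, tau <= b, G t & [/\ segint k a tau = i%:R * d, segint k t tau <= d &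
    `|F t - F a| + 2 * d * e t <=
      2 * d * e a + 4 * segint (fun t => e t * k t) a tau + 4 * i%:R * (d * d)]].
  elim=> [_|i IH Hi].
    exists a, a; split => //; split; first by rewrite segint_point mul0r.
    - by rewrite segint_point ltW.
    - by rewrite subrr normr0 segint_point !mulr0 mul0r add0r !addr0.
  have [tau [t [at_ ttau taub Gt [Jtau Jt Ht]]]] := IH (ltnW Hi).
  have atau := le_trans at_ ttau.
  have im : i.+1%:R * d <= m by rewrite -nd ler_pM2r// ler_nat.
  have [tau' tau'I Jtau'] : exists2 c, c \in `[tau, b] & segint k a c = i.+1%:R * d.
    have cts := segint_continuous ki.
    have cts' : {within `[tau, b], continuous (fun t => segint k a t)}.
      apply: continuous_subspaceW cts; exact: subset_segment.
    apply: (IVT taub cts').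
    have h1 : segint k a tau <= i.+1%:R * d by rewrite Jtau ler_pM2r// ler_nat.
    have h2 : i.+1%:R * d <= segint k a b by [].
    by rewrite ge_min le_max h1 h2 orbT.
  move: tau'I; rewrite in_itv/= => /andP[tt' t'b].
  have Jd : segint k tau tau' = d.
    have := segint_split atau tt' (segintegrable_sub ki (lexx _) t'b).
    by rewrite Jtau Jtau' -[i.+1%:R]natr1; clear; lra.
  have sub : forall g, segintegrable g a b -> segintegrable g tau tau'.
    by move=> g gi; exact: segintegrable_sub gi atau t'b.
  have k0' : forall s, tau <= s <= tau' -> 0 <= k s.
    move=> s /andP[s1 s2]; apply: k0; rewrite (le_trans atau s1)/=.
    exact: le_trans t'b.
  have Jpos : 0 < segint k tau tau' by rewrite Jd.
  have [t' [/andP[tt'' t't'] Gt' Ht']] := pick_below_mean (sub _ ki) (sub _ eki)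
    k0' (ae_subsegment HG atau t'b) Jpos (mulr_gt0 d0 d0).
  rewrite Jd in Ht'.
  have mono g x y z w : segintegrable g a b -> (forall s, a <= s <= b -> 0 <= g s) ->
      a <= x -> w <= b -> x <= y -> y <= z -> z <= w -> segint g y z <= segint g x w.
    move=> gi g0 ax wb xy yz zw; apply: segint_mono => //.
      exact: segintegrable_sub gi ax wb.
    by move=> s /andP[xs sw]; rewrite g0// (le_trans ax xs) (le_trans sw wb).
  have t'b' := le_trans t't' t'b.
  have tt1 := le_trans ttau tt''.
  exists tau', t'; split => //; first exact: le_trans tt1.
  split => //.
    by rewrite -Jd; apply: mono.
  have J2 : segint k t t' <= 2 * d.
    have : segint k t t' <= segint k t tau' by apply: mono => //.
    rewrite (segint_split ttau tt') ?(segintegrable_sub ki)// Jd; move: Jt; clear; lra.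
  have F1 : `|F t' - F a| <= `|F t' - F t| + `|F t - F a|.
    by rewrite (le_trans _ (ler_normD _ _))// addrA subrK.
  have F2 := HF t t' Gt Gt' at_ tt1 t'b'.
  have F3 : segint k t t' * (e t + e t') <= 2 * d * (e t + e t').
    by rewrite ler_wpM2r// addr_ge0.
  have -> : segint (fun t => e t * k t) a tau' =
      segint (fun t => e t * k t) a tau + segint (fun t => e t * k t) tau tau'.
    by apply: segint_split => //; exact: segintegrable_sub eki _ _.
  have -> : i.+1%:R = i%:R + 1 :> R by rewrite natr1.
  rewrite mulrDr in F3.
  set A := segint (fun t => e t * k t) a tau in Ht *.
  set B := segint (fun t => e t * k t) tau tau' in Ht' *.
  have -> : 4 * (i%:R + 1) * (d * d) = 4 * i%:R * (d * d) + 4 * (d * d) by ring.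
  set q := 4 * i%:R * (d * d) in Ht *.
  by move: Ht Ht' F1 F2 F3; clear; lra.
have [tau [t [at_ ttau taub Gt [Jtau Jt Ht]]]] := step n.+1 (leqnn _).
rewrite nd in Jtau.
have atau := le_trans at_ ttau.
have J0 : segint k tau b = 0.
  by have := segint_split atau taub ki; rewrite Jtau -/m; clear; lra.
have tb := le_trans ttau taub.
have Jtb : segint k t b <= d.
  rewrite (segint_split ttau taub) ?(segintegrable_sub ki)// J0 addr0//.
have F1 : `|F b - F a| <= `|F b - F t| + `|F t - F a|.
  by rewrite (le_trans _ (ler_normD _ _))// addrA subrK.
have F2 := HF t b Gt Gb at_ tb (lexx _).
have F3 : segint k t b * (e t + e b) <= d * (e t + e b).
  by rewrite ler_wpM2r// addr_ge0.
have WW : segint (fun t => e t * k t) a tau <= W.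
  by apply: segint_mono => // s sab; rewrite mulr_ge0// k0.
have -> : m * (2 * e a + e b + 4 * m) / n.+1%:R = 2 * d * e a + d * e b + 4 * (m * d).
  by rewrite /d; field; rewrite nat1r pnatr_eq0.
have Hm : 4 * n.+1%:R * (d * d) = 4 * (m * d) by rewrite -nd; ring.
rewrite Hm in Ht.
have := mulr_ge0 (ltW d0) (e0 t).
rewrite mulrDr in F3.
by move: Ht F1 F2 F3 WW; clear; lra.
Qed.
End chaining.

(** * From local to global bounds on increments *)

Section local_bounds.
Context {R : realType}.
Local Notation lmeasurable := (measurable : set (set (lebesgue_line R))).
Implicit Types (a b c x y : R) (g k e : R -> R) (G : set R).
Local Notation mu := (leb R).
Local Notation segint g a b := (\int[mu]_(x in `[a, b]%classic) g x).
Local Notation segintegrable g a b := (mu.-integrable `[a, b]%classic (EFin \o g)).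

Lemma segintegrable_cst c a b : segintegrable (fun=> c) a b.
Proof.
have [ab|ba] := leP a b; last first.
  by rewrite set_itv_ge ?integrable_set0// bnd_simp -ltNge.
apply: measurable_bounded_integrable.
- exact: lmeas_itv.
- by rewrite /= leb_itv// ltry.
- exact: measurable_cst.
- exact: bounded_cst.
Qed.

Lemma segint_cst c a b : a <= b -> segint (fun=> c) a b = c * (b - a).
Proof.
by move=> ab; rewrite Rintegral_cst; [rewrite /= leb_itv|exact: lmeas_itv].
Qed.

(** [pick_below_mean] with weight 1 on the middle third of [[x, y]] yields a
    point of [G] strictly between [x] and [y]. *)
Lemma ae_dense G a b x y : {ae mu, forall t, a <= t <= b -> G t} ->
  a <= x -> x < y -> y <= b -> exists t, [/\ x < t, t < y & G t].
Proof.
move=> HG ax xy yb.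
pose x' := x + (y - x) / 3; pose y' := y - (y - x) / 3.
have x'y' : x' < y' by rewrite /x' /y'; lra.
have HG' : {ae mu, forall t, x' <= t <= y' -> G t}.
  by apply: ae_subsegment HG _ _; rewrite /x' /y'; lra.
have J0 : 0 < segint (fun=> 1) x' y' by rewrite segint_cst ?ltW// mul1r subr_gt0.
have [t [/andP[xt ty] Gt _]] := @pick_below_mean _ G (fun=> 1) (fun=> 0) x' y' 1
  (segintegrable_cst _ _ _) (segintegrable_cst _ _ _) (fun _ _ => ler01) HG' J0 ltr01.
by exists t; split => //; move: xt ty; rewrite /x' /y'; lra.
Qed.

(** The bound propagates from [a] along points of [G]. At the supremum [c] of
    the points reached, the local bound around [c] allows a further step unless
    [b] has been reached; density of [G] supplies the point to step to. *)
Lemma increment_local_to_global G (F P : R -> R) a b : a <= b -> G a -> G b ->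
  (forall x y, a <= x -> x < y -> y <= b -> exists t, [/\ x < t, t < y & G t]) ->
  (forall t, a <= t <= b -> exists2 dl, 0 < dl & forall s s',
     G s -> G s' -> a <= s -> s <= s' -> s' <= b -> t - dl < s -> s' < t + dl ->
     `|F s' - F s| <= P s' - P s) ->
  `|F b - F a| <= P b - P a.
Proof.
move=> ab Ga Gb dG loc.
pose S := [set t | [/\ a <= t, t <= b, G t & `|F t - F a| <= P t - P a]].
have Sa : S a by split => //; rewrite !subrr normr0.
have supS : has_sup S by split; [exists a|exists b => t [_ tb _ _]].
set c := sup S.
have ac : a <= c by apply: sup_upper_bound.
have cb : c <= b by apply: ge_sup; [exists a|move=> t [_ tb _ _]].
have [dl dl0 H] := loc c (introT andP (conj ac cb)).
have [s [as_ sb Gs Hs] cs] := sup_adherent dl0 supS.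
have sc : s <= c by apply: sup_upper_bound => //; split.
have next s' : G s' -> s <= s' -> s' <= b -> s' < c + dl -> S s'.
  move=> Gs' ss' s'b s'c; split => //; first exact: le_trans ss'.
  have h := H s s' Gs Gs' as_ ss' s'b cs s'c.
  have := ler_normD (F s' - F s) (F s - F a); rewrite subrKA; lra.
have [cltb|] := ltP c b; last first.
  by move=> bc; have [] // : S b; apply: next => //; lra.
pose m := Num.min (c + dl) b.
have cm : c < m by rewrite lt_min cltb andbT; lra.
have mb : m <= b by rewrite ge_min lexx orbT.
have md : m <= c + dl by rewrite ge_min lexx.
have [t [ct tm Gt]] := dG c m ac cm mb.
have St : S t by apply: next => //; lra.
by have := sup_upper_bound supS St; rewrite -/c leNgt ct.
Qed.

(** Outer regularity passes to the measure with density [g] by absolute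
    continuity. *)
Lemma segint_outer_regular (A : set R) g a b h : lmeasurable A ->
  A `<=` `[a, b]%classic -> segintegrable g a b -> (forall t, a <= t <= b -> 0 <= g t) -> 0 < h ->
  exists U : set R, [/\ open U, A `<=` U &
    segint (fun t => g t * \1_(U `\` A) t) a b < h].
Proof.
move=> mA Aab gi g0 h0.
have mab := @lmeas_itv R `[a, b].
have g0' : forall t, `[a, b]%classic t -> 0 <= g t.
  by move=> t /=; rewrite in_itv/=; exact: g0.
have [dl dl0 Hdl] := integral_abs_cont mab gi g0' h0.
have Afin : (mu A < +oo)%E.
  apply: (@le_lt_trans _ _ (mu `[a, b]%classic)); first by apply: le_measure; rewrite ?inE.
  have [ab|ba] := leP a b; first by rewrite /= leb_itv// ltry.
  by rewrite set_itv_ge ?measure0// bnd_simp -ltNge.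
have [U [oU AU UA]] := leb_outer_regular mA Afin dl0.
exists U; split => //.
have mU := lmeas_open oU.
have mUA : lmeasurable (U `\` A) by exact: measurableD.
have := Hdl ((U `\` A) `&` `[a, b]%classic) (measurableI _ _ mUA mab) (@subIsetr _ _ _).
rewrite Rintegral_mkcondl.
under eq_Rintegral do rewrite patch_indic/=.
apply; apply: le_lt_trans UA; apply: le_measure; rewrite ?inE//=.
exact: measurableI.
Qed.
End local_bounds.

(** * Combining bounds on increments *)

Section combining_bounds.
Context {R : realType}.
Local Notation lmeasurable := (measurable : set (set (lebesgue_line R))).
Implicit Types (a b c x y : R) (g k e : R -> R) (G : set R).
Local Notation mu := (leb R).
Local Notation segint g a b := (\int[mu]_(x in `[a, b]%classic) g x).
Local Notation segintegrable g a b := (mu.-integrable `[a, b]%classic (EFin \o g)).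

Lemma segintegrable_measurable g a b : segintegrable g a b ->
  @measurable_fun _ _ (lebesgue_line R) R `[a, b]%classic g.
Proof. by move=> gi; apply/measurable_EFinP; exact: (measurable_int mu). Qed.

Lemma segintegrable_le g h a b : @measurable_fun _ _ (lebesgue_line R) R `[a, b]%classic g ->
  segintegrable h a b -> (forall t, a <= t <= b -> `|g t| <= `|h t|) -> segintegrable g a b.
Proof.
move=> mg hi gh; apply: (le_integrable (lmeas_itv _) _ _ hi).
  exact/measurable_EFinP.
by move=> t /=; rewrite in_itv/= lee_fin; exact: gh.
Qed.

Lemma segintegrable_indic g a b (B : set R) : lmeasurable B ->
  segintegrable g a b -> segintegrable (fun t => g t * \1_B t) a b.
Proof.
move=> mB gi; apply: (segintegrable_le _ gi).
  by apply: measurable_funM; [exact: segintegrable_measurable|exact: measurable_indic].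
move=> t _; rewrite normrM ler_piMr//.
by rewrite indicE; case: (_ \in _); rewrite ?normr1 ?normr0.
Qed.

Lemma segintegrable_min g h a b : segintegrable g a b -> segintegrable h a b ->
  segintegrable (fun t => Num.min (g t) (h t)) a b.
Proof.
move=> gi hi.
apply: (segintegrable_le _ (integrableD (lmeas_itv _) (integrable_norm gi) (integrable_norm hi))).
  by apply: measurable_minr; exact: segintegrable_measurable.
move=> t _ /=; rewrite [leRHS]ger0_norm ?addr_ge0//.
by rewrite minEle; case: ifP => _; rewrite ?lerDl ?lerDr.
Qed.

(** Let [A1] be the set where [e1 <= e2], [A2] its complement, and [U1], [U2]
    open supersets with little excess mass. Every time lies in [U1] or in [U2],
    so on short segments around it the increments of [F] are bounded by the
    integral of [g = e1 \1_U1 + e2 \1_U2]. By [increment_local_to_global] this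
    holds on [[a, b]], where the integral of [g] exceeds that of the minimum by
    at most [h]. *)
Lemma increment_le_min G e1 e2 (F : R -> R) a b : a <= b -> G a -> G b ->
  {ae mu, forall t, a <= t <= b -> G t} ->
  segintegrable e1 a b -> segintegrable e2 a b ->
  (forall t, a <= t <= b -> 0 <= e1 t) -> (forall t, a <= t <= b -> 0 <= e2 t) ->
  (forall s t, G s -> G t -> a <= s -> s <= t -> t <= b -> `|F t - F s| <= segint e1 s t) ->
  (forall s t, G s -> G t -> a <= s -> s <= t -> t <= b -> `|F t - F s| <= segint e2 s t) ->
  `|F b - F a| <= segint (fun t => Num.min (e1 t) (e2 t)) a b.
Proof.
move=> ab Ga Gb HG i1 i2 p1 p2 H1 H2.
have mab := @lmeas_itv R `[a, b].
apply/ler_addgt0Pr => h h0.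
have h20 : 0 < h / 2 by lra.
pose A1 := `[a, b]%classic `&` [set t | e1 t <= e2 t].
have mA1 : lmeasurable A1.
  by apply: measurable_fun_le => //; exact: segintegrable_measurable.
pose A2 := `[a, b]%classic `\` A1.
have mA2 : lmeasurable A2 by exact: measurableD.
have [U1 [oU1 AU1 hU1]] := segint_outer_regular mA1 (@subIsetl _ _ _) i1 p1 h20.
have [U2 [oU2 AU2 hU2]] := segint_outer_regular mA2 (@subDsetl _ _ _) i2 p2 h20.
have mU1 := lmeas_open oU1; have mU2 := lmeas_open oU2.
pose g t := e1 t * \1_U1 t + e2 t * \1_U2 t.
have gi : segintegrable g a b.
  exact: (integrableD mab (segintegrable_indic mU1 i1) (segintegrable_indic mU2 i2)).
have mini := segintegrable_min i1 i2.
have d1i : segintegrable (fun t => e1 t * \1_(U1 `\` A1) t) a b.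
  by apply: segintegrable_indic => //; exact: measurableD.
have d2i : segintegrable (fun t => e2 t * \1_(U2 `\` A2) t) a b.
  by apply: segintegrable_indic => //; exact: measurableD.
have Jg : segint g a b <= segint (fun t => Num.min (e1 t) (e2 t)) a b +
    (segint (fun t => e1 t * \1_(U1 `\` A1) t) a b + segint (fun t => e2 t * \1_(U2 `\` A2) t) a b).
  rewrite -RintegralD// -RintegralD//; last exact: (integrableD mab d1i d2i).
  apply: segint_le => //.
    exact: (integrableD mab mini (integrableD mab d1i d2i)).
  move=> t tab; have tab' : `[a, b]%classic t by rewrite /= in_itv.
  have ind_diff (U A : set R) : A `<=` U -> (\1_U t : R) = \1_A t + \1_(U `\` A) t.
    move=> AU; rewrite !indicE in_setD.
    have [tA|tA] := boolP (t \in A); last by rewrite andbT add0r.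
    by rewrite andbF addr0 mem_set//; apply: AU; exact: set_mem.
  rewrite /g (ind_diff _ _ AU1) (ind_diff _ _ AU2) !mulrDr.
  suff : e1 t * \1_A1 t + e2 t * \1_A2 t <= Num.min (e1 t) (e2 t) by clear; lra.
  rewrite /A2 !indicE in_setD (mem_set tab')/=.
  have [tA|tA] := boolP (t \in A1).
    by rewrite mulr1 mulr0 addr0 min_l//; case: (set_mem tA).
  rewrite mulr0 mulr1 add0r min_r// ltW// ltNge; apply/negP => e12.
  by move/negP: tA; apply; rewrite inE.
suff : `|F b - F a| <= segint g a b by move: hU1 hU2 Jg; clear; lra.
have -> : segint g a b = segint g a b - segint g a a by rewrite segint_point subr0.
apply: (@increment_local_to_global _ G F (fun t => segint g a t)) => //.
  by move=> x y ax xy yb; exact: ae_dense HG ax xy yb.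
move=> t tab.
have inc s s' : a <= s -> s <= s' -> s' <= b -> segint g a s' - segint g a s = segint g s s'.
  move=> as_ ss' s'b; rewrite (segint_split as_ ss') ?(segintegrable_sub gi)//.
  by rewrite addrAC subrr add0r.
have [tA1|tA2] : A1 t \/ A2 t.
  by have [?|?] := pselect (A1 t); [left|right; split => //=; rewrite in_itv].
- have : nbhs t U1 by apply: open_nbhs_nbhs; split => //; exact: AU1.
  move=> /nbhs_ballP[dl /= dl0 tU]; exists dl => // s s' Gs Gs' as_ ss' s'b st s't.
  rewrite inc//; apply: (le_trans (H1 s s' Gs Gs' as_ ss' s'b)).
  apply: segint_le; [exact: segintegrable_sub i1 _ _|exact: segintegrable_sub gi _ _|].
  move=> r /andP[sr rs']; have rab : a <= r <= b.
    by rewrite (le_trans as_ sr) (le_trans rs' s'b).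
  have rU : U1 r by apply: tU; rewrite /ball/= ltr_distl;
    clear -sr rs' st s't; apply/andP; split; lra.
  by rewrite /g [\1_U1 r]indicE mem_set// mulr1 lerDl mulr_ge0 ?p2.
- have : nbhs t U2 by apply: open_nbhs_nbhs; split => //; exact: AU2.
  move=> /nbhs_ballP[dl /= dl0 tU]; exists dl => // s s' Gs Gs' as_ ss' s'b st s't.
  rewrite inc//; apply: (le_trans (H2 s s' Gs Gs' as_ ss' s'b)).
  apply: segint_le; [exact: segintegrable_sub i2 _ _|exact: segintegrable_sub gi _ _|].
  move=> r /andP[sr rs']; have rab : a <= r <= b.
    by rewrite (le_trans as_ sr) (le_trans rs' s'b).
  have rU : U2 r by apply: tU; rewrite /ball/= ltr_distl;
    clear -sr rs' st s't; apply/andP; split; lra.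
  by rewrite /g [\1_U2 r]indicE mem_set// mulr1 lerDr mulr_ge0 ?p1.
Qed.

(** By [increment_le_min] the running minima of the [e n] bound the increments;
    they decrease to [0] a.e. and are dominated by [e 0]. *)
Lemma increment_eq0 G (e : nat -> R -> R) (F : R -> R) a b : a <= b -> G a -> G b ->
  {ae mu, forall t, a <= t <= b -> G t} ->
  (forall n, segintegrable (e n) a b) ->
  (forall n t, a <= t <= b -> 0 <= e n t) ->
  (forall n s t, G s -> G t -> a <= s -> s <= t -> t <= b ->
     `|F t - F s| <= segint (e n) s t) ->
  {ae mu, forall t, a <= t <= b -> forall h, 0 < h -> exists n, e n t < h} ->
  F b = F a.
Proof.
move=> ab Ga Gb HG ei e0 He Hinf.
have mab := @lmeas_itv R `[a, b].
pose m := fix m n := if n is n'.+1 then fun t => Num.min (m n' t) (e n t) else e 0%N.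
have mi n : segintegrable (m n) a b.
  by elim: n => [|n IH] /=; [exact: ei|exact: segintegrable_min].
have m0 n t : a <= t <= b -> 0 <= m n t.
  by move=> tab; elim: n => [|n IH] /=; [exact: e0|rewrite le_min IH e0].
have mE n t : m n t <= e n t.
  by case: n => [|n] //=; rewrite ge_min lexx orbT.
have mdec n n' t : (n <= n')%N -> m n' t <= m n t.
  elim: n' => [|n' IH]; first by rewrite leqn0 => /eqP ->.
  rewrite leq_eqVlt => /predU1P[->//|]; rewrite ltnS => /IH.
  by apply: le_trans; rewrite /= ge_min lexx.
have Fm n s t : G s -> G t -> a <= s -> s <= t -> t <= b -> `|F t - F s| <= segint (m n) s t.
  elim: n s t => [|n IH] s t Gs Gt as_ st tb; first exact: He.
  apply: (@increment_le_min G (m n) (e n.+1) F s t) => //.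
  - exact: ae_subsegment HG as_ tb.
  - exact: segintegrable_sub (mi n) as_ tb.
  - exact: segintegrable_sub (ei n.+1) as_ tb.
  - by move=> r /andP[sr rt]; apply: m0; rewrite (le_trans as_ sr) (le_trans rt tb).
  - by move=> r /andP[sr rt]; apply: e0; rewrite (le_trans as_ sr) (le_trans rt tb).
  - move=> x y Gx Gy sx xy yt; apply: IH => //.
      exact: le_trans sx.
    exact: le_trans tb.
  - move=> x y Gx Gy sx xy yt; apply: He => //.
      exact: le_trans sx.
    exact: le_trans tb.
have cvgm : {ae mu, forall t, `[a, b]%classic t ->
    (m n t)%:E @[n --> \oo] --> 0%E}.
  apply: filterS Hinf => t Ht /=; rewrite in_itv/= => tab.
  apply/fine_cvgP; split; first exact: nearW.
  apply/(@cvgrPdist_lt _ R^o) => h h0; have [n en] := Ht tab h h0.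
  near=> n'; rewrite sub0r normrN/= ger0_norm ?m0//.
  apply: (le_lt_trans _ en); apply: (le_trans _ (mE n t)); apply: mdec.
  by near: n'; exact: nbhs_infty_ge.
have dom : {ae mu, forall t n, `[a, b]%classic t ->
    (`|(m n t)%:E| <= (e 0%N t)%:E)%E}.
  apply/aeW => t n /=; rewrite in_itv/= => tab.
  by rewrite lee_fin ger0_norm ?m0//; exact: (mdec 0%N).
have [_ _] := @dominated_convergence _ _ _ mu _ mab (fun n => EFin \o m n) (cst 0%E)
  (EFin \o e 0%N) (fun n => measurable_int mu (mi n)) (measurable_cst _) cvgm (ei 0%N) dom.
rewrite integral0 => /fine_cvgP[_] /(@cvgrPdist_lt _ R^o) cv.
apply/eqP; rewrite -subr_eq0 -normr_le0; apply/ler_addgt0Pr => h /cv[n _].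
move=> /(_ n (leqnn _))/=; rewrite !add0r normrN => /ltW; apply: le_trans.
rewrite (le_trans (Fm n a b Ga Gb (lexx _) ab (lexx _)))//.
exact: ler_norm.
Unshelve. all: by end_near. Qed.
End combining_bounds.

(** * Real-valued norms, dual functionals and inner products *)

Section real_norm.
Context {R : realType} {V : normedModType R[i]}.
Implicit Types (x y : V) (r : R).

Lemma rnormE x : `|x| = (rnorm x)%:C.
Proof. by rewrite /rnorm RRe_real// ger0_real. Qed.

Lemma rnorm_ge0 x : 0 <= rnorm x.
Proof. by rewrite -lecR -rnormE normr_ge0. Qed.

Lemma rnorm0 : rnorm (0 : V) = 0.
Proof. by rewrite /rnorm normr0. Qed.

Lemma rnorm0_eq0 x : rnorm x = 0 -> x = 0.
Proof. by move=> x0; apply/eqP; rewrite -normr_eq0 rnormE x0. Qed.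

Lemma rnormD x y : rnorm (x + y) <= rnorm x + rnorm y.
Proof. by rewrite -lecR rmorphD/= -!rnormE ler_normD. Qed.

Lemma rnormN x : rnorm (- x) = rnorm x.
Proof. by rewrite /rnorm normrN. Qed.

Lemma rnormB x y : rnorm (x - y) = rnorm (y - x).
Proof. by rewrite /rnorm distrC. Qed.

Lemma rnorm_tri x y z : rnorm (x - z) <= rnorm (x - y) + rnorm (y - z).
Proof. by have := rnormD (x - y) (y - z); rewrite addrA subrK. Qed.

Lemma rnorm_dist x y : `|rnorm x - rnorm y| <= rnorm (x - y).
Proof.
have := rnormD (x - y) y; have := rnormD (y - x) x.
rewrite !subrK (rnormB y) ler_norml; lra.
Qed.

Lemma rnormZ (c : R[i]) x : rnorm (c *: x) = complex.Re `|c| * rnorm x.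
Proof.
by apply: complexI; rewrite rmorphM/= -!rnormE normrZ.
Qed.

Lemma rnormZr r x : 0 <= r -> rnorm (r%:C *: x) = r * rnorm x.
Proof.
by move=> r0; rewrite rnormZ normc_def/= expr0n/= addr0 sqrtr_sqr ger0_norm.
Qed.

Lemma cvg_rnormP T (F : set_system T) {FF : Filter F} (h : T -> V) (l : V) :
  h @ F --> l <-> forall e : R, 0 < e -> \forall t \near F, rnorm (l - h t) < e.
Proof.
split=> [/cvgrPdist_lt H e e0|H].
  have e0' : 0 < e%:C by rewrite ltcR.
  by apply: filterS (H _ e0') => t; rewrite rnormE ltcR.
apply/cvgrPdist_lt => e; rewrite ltcE/= => /andP[/eqP Ie /H].
by apply: filterS => t; rewrite rnormE ltcE/= Ie eqxx.
Qed.

End real_norm.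

Lemma ReB (R : realType) (z w : R[i]) :
  complex.Re (z - w) = complex.Re z - complex.Re w.
Proof. by case: z w => [? ?] [? ?]. Qed.

Lemma ReD (R : realType) (z w : R[i]) :
  complex.Re (z + w) = complex.Re z + complex.Re w.
Proof. by case: z w => [? ?] [? ?]. Qed.

Lemma ler_Re (R : realType) (z : R[i]) : `|complex.Re z| <= complex.Re `|z|.
Proof. by have := normc_ge_Re z; rewrite lecE => /andP[]. Qed.

Section dual_bounds.
Context {R : realType} {V : normedModType R[i]}.
Implicit Types (x y : V) (f : dual V).

Lemma dual_has_sup f :
  has_sup [set complex.Re `|f x| | x in [set x | rnorm x <= 1]].
Proof.
have [M HM] := dual_bounded f.
split; first by exists (complex.Re `|f 0|), 0 => //=; rewrite rnorm0.
exists `|M| => _ [z /= z1 <-].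
apply: (le_trans (HM z)); apply: (le_trans (ler_norm _)).
by rewrite normrM ler_piMr// ger0_norm ?rnorm_ge0.
Qed.

Lemma dual_norm_bound f x : complex.Re `|f x| <= dual_norm f * rnorm x.
Proof.
have [->|x0] := eqVneq x 0.
  by rewrite linear0 normr0/= rnorm0 mulr0.
have nx0 : 0 < rnorm x.
  rewrite lt_neqAle rnorm_ge0 andbT eq_sym; apply/eqP => /rnorm0_eq0 x0'.
  by rewrite x0' eqxx in x0.
pose y := (rnorm x)^-1%:C *: x.
have ny : rnorm y = 1.
  by rewrite /y rnormZr ?invr_ge0 ?ltW// mulVf ?gt_eqF.
have fy : complex.Re `|f y| = (rnorm x)^-1 * complex.Re `|f x|.
  have -> : f y = Num.conj (rnorm x)^-1%:C * f x by rewrite /y linearZ_LR.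
  rewrite normrM.
  have -> : `|Num.conj (rnorm x)^-1%:C : R[i]| = (rnorm x)^-1%:C.
    by rewrite norm_conjC normc_def/= expr0n/= addr0 sqrtr_sqr ger0_norm ?invr_ge0 ?ltW.
  rewrite [in LHS](_ : `|f x| = (complex.Re `|f x|)%:C); last by rewrite RRe_real// ger0_real.
  by rewrite -rmorphM.
rewrite -ler_pdivrMr// mulrC -fy.
apply: sup_upper_bound; first exact: dual_has_sup.
by exists y => //=; rewrite ny.
Qed.

Lemma dual_Re_bound f x : `|complex.Re (f x)| <= dual_norm f * rnorm x.
Proof. exact: le_trans (ler_Re _) (dual_norm_bound _ _). Qed.

Lemma dual_norm_ge0 f : 0 <= dual_norm f.
Proof.
apply: sup_upper_bound; first exact: dual_has_sup.
by exists 0; [rewrite /= rnorm0|rewrite linear0 normr0].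
Qed.

Lemma dual_ReB f x y : complex.Re (f (x - y)) = complex.Re (f x) - complex.Re (f y).
Proof. by rewrite linearB ReB. Qed.

Lemma dual_Im f x : complex.Im (f x) = complex.Re (f ('i *: x)).
Proof.
rewrite linearZ_LR/=; case: (f x) => a b.
by rewrite /=; simpc.
Qed.
End dual_bounds.

Section real_inner_product.
Context {R : realType} {H : normedModType R[i]} (ip : {dot H for Num.conj}).
Hypothesis ip_norm : forall x : H, `|x| ^+ 2 = ip x x.
Implicit Types x y z : H.

(** The real inner product underlying [ip]: its norm is [rnorm], and [ip_Im]
    recovers the imaginary parts from it. *)
Definition rip x y : R := complex.Re (ip x y).

Lemma ripBl x y z : rip (x - y) z = rip x z - rip y z.
Proof. by rewrite /rip linearBl ReB. Qed.

Lemma ripDl x y z : rip (x + y) z = rip x z + rip y z.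
Proof. by rewrite /rip linearDl ReD. Qed.

Lemma ripC x y : rip x y = rip y x.
Proof.
rewrite /rip (hermC ip x y)/= expr0 mul1r.
by case: (ip y x).
Qed.

Lemma ripxx x : rip x x = rnorm x ^+ 2.
Proof. by rewrite /rip -ip_norm rnormE -rmorphXn. Qed.

Lemma ripDr x y z : rip z (x + y) = rip z x + rip z y.
Proof. by rewrite ripC ripDl !(ripC z). Qed.

Lemma ripBr x y z : rip z (x - y) = rip z x - rip z y.
Proof. by rewrite ripC ripBl !(ripC z). Qed.

(** Cauchy-Schwarz amounts to the triangle inequality for [x + y] and [x - y],
    which the given norm satisfies. *)
Lemma rip_le x y : `|rip x y| <= rnorm x * rnorm y.
Proof.
have h1 : rnorm (x + y) ^+ 2 <= (rnorm x + rnorm y) ^+ 2.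
  by rewrite lerXn2r ?nnegrE ?addr_ge0 ?rnorm_ge0// rnormD.
have h2 : rnorm (x - y) ^+ 2 <= (rnorm x + rnorm y) ^+ 2.
  rewrite lerXn2r ?nnegrE ?addr_ge0 ?rnorm_ge0//.
  by rewrite (le_trans (rnormD _ _))// rnormN.
move: h1 h2; rewrite -(ripxx (x + y)) -(ripxx (x - y)) ripBl !ripBr ripDl !ripDr.
rewrite !ripxx (ripC y x) sqrrD ler_norml; lra.
Qed.

Lemma ip_Im x y : complex.Im (ip x y) = rip x ('i *: y).
Proof.
rewrite /rip linearZr_LR/=; case: (ip x y) => a b.
by rewrite /=; simpc.
Qed.

End real_inner_product.

(** * The energy increment between good times *)

Section energy.
Context {R : realType}.
Local Notation lmeasurable := (measurable : set (set (lebesgue_line R))).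

Lemma increment_shift (a b m n l : R) : m = n + l ->
  (a - 2 * m) - (b - 2 * n) = (a - b) - 2 * l.
Proof. by move=> ->; ring. Qed.

Lemma replace_frozen (x a b w : R) : `|x - 2 * a| <= 4 * w -> `|a - b| <= w ->
  `|x - 2 * b| <= 6 * w.
Proof. by rewrite !ler_norml => /andP[? ?] /andP[? ?]; lra. Qed.

Context {V : normedModType R[i]}.
Local Notation mu := (leb R).
Local Notation segint g a b := (\int[mu]_(x in `[a, b]%classic) g x).
Local Notation segintegrable g a b := (mu.-integrable `[a, b]%classic (EFin \o g)).
Variables (T : R) (G : set R) (k : R -> R) (v : R -> V) (q : R -> V -> R).
Variables (phi : R -> R) (X : nat -> V).
Hypothesis G_ae : {ae mu, forall t, 0 <= t <= T -> G t}.
Hypothesis k_int : segintegrable k 0 T.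
Hypothesis k_ge0 : forall t, 0 <= t <= T -> 0 <= k t.
Hypothesis v_int : forall x, segintegrable (fun t => rnorm (v t - x) * k t) 0 T.
Hypothesis q_int : forall x, segintegrable (fun t => q t x) 0 T.
Hypothesis qv_int : segintegrable (fun t => q t (v t)) 0 T.
Hypothesis q_le : forall t x, 0 <= t <= T -> `|q t x| <= k t * rnorm x.
Hypothesis qB : forall t x y, q t (x - y) = q t x - q t y.
Hypothesis phiE : forall s t, G s -> G t -> 0 <= s -> s <= t -> t <= T ->
  phi t - phi s = segint (fun r => q r (v t)) s t + segint (fun r => q r (v s)) s t.
Hypothesis X_dense : forall t, G t -> forall h : R, 0 < h -> exists n, rnorm (v t - X n) < h.

Lemma segint_pairing_le x s t : 0 <= s -> t <= T ->
  `|segint (fun r => q r x) s t| <= segint k s t * rnorm x.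
Proof.
move=> s0 tT; rewrite -RintegralZr//; [|exact: lmeas_itv|exact: segintegrable_sub k_int s0 tT].
have ki : segintegrable (fun r => k r * rnorm x) s t.
  exact: (integrableZr (lmeas_itv _) (rnorm x) (segintegrable_sub k_int s0 tT)).
apply: segint_norm_le => //; first exact: segintegrable_sub (q_int x) s0 tT.
by move=> r /andP[sr rt]; apply: q_le; rewrite (le_trans s0 sr) (le_trans rt tT).
Qed.

Lemma segint_pairingB x y s t : 0 <= s -> t <= T ->
  segint (fun r => q r x) s t - segint (fun r => q r y) s t = segint (fun r => q r (x - y)) s t.
Proof.
move=> s0 tT; rewrite -RintegralB//; first by apply: eq_Rintegral => r _; rewrite qB.
- exact: lmeas_itv.
- exact: segintegrable_sub (q_int x) s0 tT.
- exact: segintegrable_sub (q_int y) s0 tT.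
Qed.

(** With [<vs, x>] subtracted, increments of the energy only involve the
    distances of [v] to [x] at the end points, so that chaining applies. *)
Lemma energy_frozen x a b : G a -> G b -> 0 <= a -> a <= b -> b <= T ->
  `|(phi b - phi a) - 2 * segint (fun r => q r x) a b| <=
  4 * segint (fun t => rnorm (v t - x) * k t) a b.
Proof.
move=> Ga Gb a0 ab bT.
pose F t := phi t - 2 * segint (fun r => q r x) 0 t.
have FE s t : a <= s -> s <= t -> t <= b ->
    F t - F s = (phi t - phi s) - 2 * segint (fun r => q r x) s t.
  move=> as_ st tb; have s0 := le_trans a0 as_.
  apply: increment_shift (segint_split s0 st _).
  exact: segintegrable_sub (q_int x) (lexx _) (le_trans tb bT).
rewrite -FE//; apply: (@increment_chaining _ G k (fun t => rnorm (v t - x)) F a b) => //.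
- exact: segintegrable_sub k_int a0 bT.
- exact: segintegrable_sub (v_int x) a0 bT.
- by move=> t /andP[at_ tb]; rewrite k_ge0// (le_trans a0 at_) (le_trans tb bT).
- by move=> t; exact: rnorm_ge0.
- exact: ae_subsegment G_ae a0 bT.
- move=> s t Gs Gt as_ st tb; rewrite FE//.
  have s0 := le_trans a0 as_; have tT := le_trans tb bT.
  rewrite phiE//.
  have -> : segint (fun r => q r (v t)) s t + segint (fun r => q r (v s)) s t -
      2 * segint (fun r => q r x) s t =
      segint (fun r => q r (v t - x)) s t + segint (fun r => q r (v s - x)) s t.
    by rewrite -!segint_pairingB//; lra.
  rewrite (le_trans (ler_normD _ _))// addrC mulrDr lerD// segint_pairing_le//.
Qed.

(** Replacing [x] by [v] under the integral in [energy_frozen] costs another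
    [2 \int ||v - x|| dm], which leaves the bound
    [6 \int ||v - x|| dm] for each [x]; take the [x] in the dense sequence. *)
Lemma energy_increment a b : G a -> G b -> 0 <= a -> a <= b -> b <= T ->
  phi b - phi a = 2 * segint (fun t => q t (v t)) a b.
Proof.
move=> Ga Gb a0 ab bT.
have mI s t : lmeasurable `[s, t]%classic by exact: lmeas_itv.
pose F t := phi t - 2 * segint (fun r => q r (v r)) 0 t.
have FE s t : a <= s -> s <= t -> t <= b ->
    F t - F s = (phi t - phi s) - 2 * segint (fun r => q r (v r)) s t.
  move=> as_ st tb; have s0 := le_trans a0 as_.
  exact: increment_shift (segint_split s0 st (segintegrable_sub qv_int (lexx _) (le_trans tb bT))).
suff : F b = F a by move=> FF; have := FE a b (lexx _) ab (lexx _); rewrite FF; lra.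
pose e n t := 6 * (rnorm (v t - X n) * k t).
have ei n : segintegrable (e n) 0 T by exact: (integrableZl (mI _ _) 6 (v_int (X n))).
have tI t : a <= t <= b -> 0 <= t <= T.
  by move=> /andP[at_ tb]; rewrite (le_trans a0 at_) (le_trans tb bT).
apply: (@increment_eq0 _ G e F a b) => //.
- exact: ae_subsegment G_ae a0 bT.
- by move=> n; exact: segintegrable_sub (ei n) a0 bT.
- by move=> n t /tI tI'; rewrite mulr_ge0// mulr_ge0 ?rnorm_ge0 ?k_ge0.
- move=> n s t Gs Gt as_ st tb; rewrite FE//.
  have s0 := le_trans a0 as_; have tT := le_trans tb bT.
  have vXi := segintegrable_sub (v_int (X n)) s0 tT.
  have qvi := segintegrable_sub qv_int s0 tT.
  have qXi := segintegrable_sub (q_int (X n)) s0 tT.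
  rewrite /e RintegralZl//.
  have h1 := energy_frozen (X n) Gs Gt s0 st tT.
  have h2 : `|segint (fun r => q r (X n)) s t - segint (fun r => q r (v r)) s t| <=
      segint (fun t => rnorm (v t - X n) * k t) s t.
    rewrite -RintegralB//; apply: segint_norm_le => //.
      exact: (integrableB (mI _ _) qXi qvi).
    move=> r /andP[sr rt]; rewrite -qB mulrC rnormB; apply: q_le.
    by rewrite (le_trans s0 sr) (le_trans rt tT).
  exact: replace_frozen h1 h2.
- apply: filterS (ae_subsegment G_ae a0 bT) => t Gt tab h h0.
  have kt := k_ge0 (tI _ tab).
  have [//|n hn] := @X_dense t (Gt tab) (h / (6 * k t + 1)).
    by rewrite divr_gt0//; lra.
  exists n; rewrite /e; move: hn; rewrite ltr_pdivlMr; last by lra.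
  have := rnorm_ge0 (v t - X n); nra.
Qed.

End energy.

(** * Continuous extension from good times *)

Section continuous_version.
Context {R : realType}.
Local Notation mu := (leb R).
Local Notation segint g a b := (\int[mu]_(x in `[a, b]%classic) g x).
Local Notation segintegrable g a b := (mu.-integrable `[a, b]%classic (EFin \o g)).

(** Within a short segment around [t0], a point [s] of [G] where [e] is below
    its mean has [e s * m <= \int e k], with [m] the [k dt]-mass of the whole
    segment; the right-hand side is small. The lower bound on [k] makes [m]
    positive. *)
Lemma good_point_near (G : set R) (k e : R -> R) T t0 d h : 0 < T -> 0 <= t0 <= T ->
  {ae mu, forall t, 0 <= t <= T -> G t} ->
  segintegrable k 0 T -> segintegrable (fun t => e t * k t) 0 T ->
  (forall t, 0 <= t <= T -> 1 <= k t) -> (forall t, 0 <= e t) -> 0 < d -> 0 < h ->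
  exists s, [/\ 0 <= s <= T, G s, `|s - t0| < d &
    `|segint k 0 s - segint k 0 t0| * e s <= h].
Proof.
move=> T0 /andP[t00 t0T] HG ki eki k1 e0 d0 h0.
have h20 : 0 < h / 2 by lra.
have [dl dl0 Hdl] := segint_unif_cont eki h20.
pose d' := Num.min (d / 2) (dl / 4).
have d'0 : 0 < d' by rewrite lt_min; apply/andP; split; lra.
have d'd : d' <= d / 2 by rewrite ge_min lexx.
have d'dl : d' <= dl / 4 by rewrite ge_min lexx orbT.
have [td1 td2] : t0 - d' <= t0 /\ t0 <= t0 + d' by clear -d'0; split; lra.
pose x := Num.max 0 (t0 - d'); pose y := Num.min T (t0 + d').
have x0 : 0 <= x by rewrite le_max lexx.
have yT : y <= T by rewrite ge_min lexx.
have xt : x <= t0 by rewrite ge_max t00.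
have ty : t0 <= y by rewrite le_min t0T.
have xd : t0 - d' <= x by rewrite le_max lexx orbT.
have yd : y <= t0 + d' by rewrite ge_min lexx orbT.
have xy : x < y.
  rewrite /x /y lt_min !gt_max T0 /=; clear -t00 t0T d'0.
  by apply/andP; split; [|apply/andP; split]; lra.
clearbody x y d'.
have ki' := segintegrable_sub ki x0 yT; have eki' := segintegrable_sub eki x0 yT.
have k1' t : x <= t <= y -> 1 <= k t.
  by move=> /andP[xt' ty']; rewrite k1// (le_trans x0 xt') (le_trans ty' yT).
have Jpos : 0 < segint k x y.
  apply: (@lt_le_trans _ _ (segint (fun=> 1) x y)).
    by rewrite segint_cst ?ltW// mul1r subr_gt0.
  by apply: segint_le => //; exact: segintegrable_cst.
have [s [/andP[xs sy] Gs Hs]] := pick_below_mean ki' eki'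
  (fun t tI => le_trans ler01 (k1' t tI)) (ae_subsegment HG x0 yT) Jpos h20.
have sT : 0 <= s <= T by rewrite (le_trans x0 xs) (le_trans sy yT).
exists s; split => //.
  by rewrite ltr_norml; clear -xs sy xd yd d'd d0; apply/andP; split; lra.
have k0 t : 0 <= t <= T -> 0 <= k t by move=> /k1; apply: le_trans.
have JJ : `|segint k 0 s - segint k 0 t0| <= segint k x y.
  have mono p r : x <= p -> p <= r -> r <= y -> `|segint k 0 r - segint k 0 p| <= segint k x y.
    move=> xp pr ry; have p0 := le_trans x0 xp.
    rewrite (segint_split p0 pr (segintegrable_sub ki (lexx _) (le_trans ry yT))).
    rewrite addrAC subrr add0r ger0_norm; last first.
      apply: segint_ge0 => t /andP[pt tr]; apply: k0.
      by rewrite (le_trans p0 pt) (le_trans tr (le_trans ry yT)).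
    by apply: segint_mono => // t tI; exact: le_trans ler01 (k1' t tI).
  by have [st|/ltW ts] := leP s t0; [rewrite distrC|]; apply: mono.
have : segint (fun t => e t * k t) x y < h / 2.
  have ekx : segintegrable (fun t => `|e t * k t|) x y by exact: integrable_norm.
  apply: (@le_lt_trans _ _ (segint (fun t => `|e t * k t|) x y)).
    by apply: segint_le => // t _; exact: ler_norm.
  by apply: Hdl => //; [exact: ltW|clear -xd yd d'dl d'0; lra].
by move: Hs => /[swap]; have := ler_wpM2r (e0 s) JJ; clear; lra.
Qed.

(** [u t] is the limit of [w] along [S] at [t], which exists by completeness. *)
Lemma extend_continuous (H : completeNormedModType R[i]) (w : R -> H) (S : set R) T :
  S `<=` `[0, T]%classic ->
  (forall t d : R, 0 <= t <= T -> 0 < d -> exists2 s, S s & `|s - t| < d) ->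
  (forall t e : R, 0 <= t <= T -> 0 < e -> exists2 dl : R, 0 < dl & forall s s',
    S s -> S s' -> `|s - t| < dl -> `|s' - t| < dl -> rnorm (w s - w s') < e) ->
  exists2 u : R -> H, {within `[0, T]%classic, continuous u} &
    forall t, S t -> u t = w t.
Proof.
move=> ST dS cS.
pose F (t : R) := within S (nbhs t).
have FF (t : R) : Filter (F t) by exact: within_filter.
have PF (t : R) : 0 <= t <= T -> ProperFilter (F t).
  move=> tT; apply: Build_ProperFilter_ex => B.
  move=> /nbhs_ballP[d /= d0 dB]; have [s Ss st] := dS t d tT d0.
  by exists s; apply: dB => //; rewrite /ball/= distrC.
have cvgF (t : R) : 0 <= t <= T -> cvg (w @ F t).
  move=> tT; have PFt := PF _ tT; apply: cauchy_cvg; apply: cauchy_exP => e e0.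
  have er0 : 0 < complex.Re e by move: e0; rewrite ltcE => /andP[].
  have ee : e = (complex.Re e)%:C by rewrite RRe_real// gtr0_real.
  have [dl dl0 Hdl] := cS t _ tT er0.
  have [s Ss st] := dS t dl tT dl0.
  exists (w s); rewrite /= /F; apply/nbhs_ballP; exists dl => //= s' s's Ss'.
  rewrite -ball_normE/= ee rnormE ltcR; apply: Hdl => //.
  by rewrite distrC.
pose u t := lim (w @ F t).
have uP (t e : R) : 0 <= t <= T -> 0 < e -> exists2 dl, 0 < dl & forall s, S s ->
    `|s - t| < dl -> rnorm (u t - w s) < e.
  move=> tT e0; have PFt := PF _ tT.
  have := cvgF t tT; rewrite -/(u t) => /(cvg_rnormP (F := F t)) /(_ e e0).
  move=> /nbhs_ballP[dl /= dl0 Hdl]; exists dl => // s Ss st.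
  by apply: Hdl => //; rewrite /ball/= distrC.
exists u; last first.
  move=> t St; have tT : 0 <= t <= T by have := ST _ St; rewrite /= in_itv.
  apply/eqP; rewrite -subr_eq0; apply/eqP/rnorm0_eq0/eqP.
  rewrite eq_le rnorm_ge0 andbT; apply/ler_addgt0Pr => e e0; rewrite add0r.
  have [dl dl0 Hdl] := uP t e tT e0.
  by apply/ltW/Hdl => //; rewrite subrr normr0.
apply/subspace_continuousP => t /=; rewrite in_itv/= => tT.
apply/cvg_rnormP => e e0; have e20 : 0 < e / 2 by lra.
have [dl dl0 Hdl] := uP t _ tT e20.
rewrite near_withinE; apply/nbhs_ballP; exists (dl / 2); first by rewrite /=; lra.
move=> t'; rewrite /ball/= => tt'; rewrite in_itv/= => t'T.
have [dl' dl'0 Hdl'] := uP t' _ t'T e20.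
have [|s Ss] := dS t' (Num.min dl' (dl / 2)) t'T.
  by rewrite lt_min dl'0/=; lra.
rewrite lt_min => /andP[s1 s2].
have := rnorm_tri (u t) (w s) (u t').
have := Hdl' s Ss s1; rewrite (rnormB (u t')).
suff /(Hdl s Ss) : `|s - t| < dl by lra.
have := ler_normD (s - t') (t' - t); rewrite subrKA (distrC t' t); lra.
Qed.

(** Fix [s] in [G] near [t] with [m([s, t]) * e s] small. For all [r] in [G]
    near [t] the energy estimate makes [w r] close to this one vector [w s], so
    [w] is Cauchy along [G] at [t]. *)
Lemma cauchy_of_energy (H : completeNormedModType R[i]) (w : R -> H) (G : set R)
    (k e Q : R -> R) T : 0 < T ->
  {ae mu, forall t, 0 <= t <= T -> G t} ->
  segintegrable k 0 T -> segintegrable (fun t => e t * k t) 0 T -> segintegrable Q 0 T ->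
  (forall t, 0 <= t <= T -> 1 <= k t) -> (forall t, 0 <= e t) ->
  (forall s t, G s -> G t -> 0 <= s <= T -> 0 <= t <= T ->
    rnorm (w t - w s) ^+ 2 <=
    `|segint Q 0 t - segint Q 0 s| + 2 * (`|segint k 0 t - segint k 0 s| * e s)) ->
  exists2 u : R -> H, {within `[0, T]%classic, continuous u} &
    forall t, 0 <= t <= T -> G t -> u t = w t.
Proof.
move=> T0 HG ki eki Qi k1 e0 Hw.
pose S := G `&` `[0, T]%classic.
have [|||u uc uw] := @extend_continuous H w S T; last first.
- by exists u => // t tT Gt; apply: uw; split => //=; rewrite in_itv.
- move=> t eps tT eps0.
  (* [rnorm (w r - w s) ^+ 2] will be at most [2 h + 2 (2 h) = 6 h], which is
     below [(eps / 2) ^+ 2 = 8 h]. *)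
  pose h := eps ^+ 2 / 32.
  have h0 : 0 < h by rewrite divr_gt0// exprn_gt0.
  have [d1 d10 H1] := segint_cont_modulus Qi h0.
  have [s [sT Gs st Hs]] := good_point_near T0 tT HG ki eki k1 e0 d10 h0.
  have h20 : 0 < h / (e s + 1) by rewrite divr_gt0// ltr_wpDl.
  have [d2 d20 H2] := segint_cont_modulus ki h20.
  have close r : G r -> 0 <= r <= T -> `|r - t| < Num.min d1 d2 -> rnorm (w r - w s) < eps / 2.
    move=> Gr rT; rewrite lt_min => /andP[r1 r2].
    have q1 := H1 r t rT tT r1; have q2 := H1 s t sT tT st.
    have m1 := H2 r t rT tT r2.
    have q : `|segint Q 0 r - segint Q 0 s| <= h + h.
      have := ler_normD (segint Q 0 r - segint Q 0 t) (segint Q 0 t - segint Q 0 s).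
      rewrite subrKA (distrC (segint Q 0 t)) => tri; apply: (le_trans tri).
      by rewrite lerD// ltW.
    have m : `|segint k 0 r - segint k 0 s| * e s <= h + h.
      have := ler_normD (segint k 0 r - segint k 0 t) (segint k 0 t - segint k 0 s).
      rewrite subrKA (distrC (segint k 0 t)) => tri.
      apply: (le_trans (ler_wpM2r (e0 s) tri)); rewrite mulrDl lerD//.
      move: m1; rewrite ltr_pdivlMr ?ltr_wpDl// => m1.
      by apply: le_trans (ltW m1); apply: ler_wpM2l => //; rewrite lerDl.
    have := Hw s r Gs Gr sT rT => W.
    rewrite ltNge; apply/negP => big.
    have : (eps / 2) ^+ 2 <= rnorm (w r - w s) ^+ 2.
      by rewrite lerXn2r ?nnegrE ?rnorm_ge0// divr_ge0// ltW.
    rewrite expr_div_n => /le_trans /(_ W); apply/negP; rewrite -ltNge.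
    apply: (le_lt_trans (lerD q (ler_wpM2l _ m))) => //.
    by rewrite /h; have := exprn_gt0 2 eps0; clear; lra.
  exists (Num.min d1 d2); first by rewrite lt_min d10 d20.
  move=> r r' [Gr /=]; rewrite in_itv/= => rT [Gr' /=]; rewrite in_itv/= => r'T c1 c2.
  have := close r Gr rT c1; have := close r' Gr' r'T c2.
  rewrite (rnormB (w r')); have := rnorm_tri (w r) (w s) (w r'); clear; lra.
- move=> t d tT d0.
  have [s [sT Gs st _]] := good_point_near T0 tT HG ki eki k1 e0 d0 ltr01.
  by exists s => //; split => //=; rewrite in_itv.
- exact: subIsetr.
Qed.

End continuous_version.

(** * Measurability and integrability of the data *)

Section measurability_integrability.
Context {R : realType}.
Local Notation lmeasurable := (measurable : set (set (lebesgue_line R))).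
Local Notation mu := (leb R).
Local Notation segint g a b := (\int[mu]_(x in `[a, b]%classic) g x).
Local Notation segintegrable g a b := (mu.-integrable `[a, b]%classic (EFin \o g)).
Local Notation lmeasurable_fun := (@measurable_fun _ _ (lebesgue_line R) R).

Lemma lmeasurable_ae (D : set R) (g h : R -> R) : lmeasurable_fun D g ->
  {ae mu, forall t, D t -> g t = h t} -> lmeasurable_fun D h.
Proof.
move=> mg gh; apply/measurable_EFinP.
apply: (ae_measurable_fun completed_lebesgue_measure_is_complete
  (f := EFin \o g)); last exact/measurable_EFinP.
by apply: filterS gh => t H Dt /=; rewrite H.
Qed.

(** Off the exceptional null set the limit is measurable; on it, completeness of
    the measure leaves the values free. *)
Lemma lmeasurable_ae_lim (D : set R) (h : nat -> R -> R) (g : R -> R) :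
  (forall n, lmeasurable_fun D (h n)) ->
  {ae mu, forall t, D t -> h n t @[n --> \oo] --> g t} -> lmeasurable_fun D g.
Proof.
move=> mh [N [mN N0 HN]].
have m1 : lmeasurable_fun D (fun t => g t * \1_(~` N) t).
  apply: (@measurable_fun_cvg _ (lebesgue_line R) R D (fun n t => h n t * \1_(~` N) t)).
    move=> n; apply: measurable_funM => //; apply: measurable_indic.
    exact: measurableC.
  move=> t Dt; rewrite indicE; have [tN|tN] := boolP (t \in ~` N).
    rewrite mulr1; under eq_cvg do rewrite mulr1.
    move: tN; rewrite inE => tN; apply: contrapT => C; apply: tN; apply: HN.
    by move=> H; apply: C; exact: H.
  rewrite mulr0; under eq_cvg do rewrite mulr0.
  exact: cvg_cst.
apply: lmeasurable_ae m1 _; exists N; split => // t /= C.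
apply: contrapT => tN; apply: C => Dt.
by rewrite indicE mem_set ?mulr1.
Qed.

Lemma lmeasurable_simple_comp {V : normedModType R[i]} (D : set R) (s : {fimfun R >-> V})
    (F : R -> V -> R) :
  (forall x, lmeasurable (D `&` (s @^-1` [set x]))) ->
  (forall x, lmeasurable_fun D (fun t => F t x)) ->
  lmeasurable_fun D (fun t => F t (s t)).
Proof.
move=> ms mF mD B mB.
rewrite (_ : D `&` _ = \bigcup_(x in range s)
    ((D `&` (s @^-1` [set x])) `&` (D `&` (fun t => F t x) @^-1` B))).
  apply: fin_bigcup_measurable; first exact: fimfunP.
  by move=> x _; apply: measurableI => //; exact: mF.
apply/seteqP; split=> t /=.
  by move=> [Dt Bt]; exists (s t).
by move=> [x _ [[Dt <-] [_ Bt]]].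
Qed.

(** As [F] is Lipschitz in space, [F t (v t)] is a.e. the limit of [F] along the
    simple approximations of [v], where only measurability in time matters. *)
Lemma lmeasurable_strongly_comp {V : normedModType R[i]} (D : set R) (v : R -> V)
    (F : R -> V -> R) (C : R -> R) : strongly_measurable D v ->
  (forall x, lmeasurable_fun D (fun t => F t x)) ->
  (forall t, D t -> forall x y, `|F t x - F t y| <= C t * rnorm (x - y)) ->
  lmeasurable_fun D (fun t => F t (v t)).
Proof.
move=> [s ms sv] mF FC.
apply: (@lmeasurable_ae_lim D (fun n t => F t (s n t))).
  by move=> n; apply: lmeasurable_simple_comp.
apply: filterS sv => t Ht Dt; have /cvg_rnormP H := Ht Dt.
apply/(@cvgrPdist_lt _ R^o) => e e0.
have Ct : 0 < `|C t| + 1 by rewrite ltr_wpDl.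
have e1 : 0 < e / (`|C t| + 1) by rewrite divr_gt0.
apply: filterS (H _ e1) => n; rewrite ltr_pdivlMr// => Hn.
apply: (le_lt_trans (FC t Dt _ _)); apply: le_lt_trans Hn; rewrite mulrC.
by apply: ler_wpM2l; [exact: rnorm_ge0|rewrite (le_trans (ler_norm _))// lerDl].
Qed.

Lemma integrable_ae_le (D : set R) (g h : R -> R) :
  lmeasurable D -> lmeasurable_fun D g ->
  mu.-integrable D (EFin \o h) -> {ae mu, forall t, D t -> `|g t| <= h t} ->
  mu.-integrable D (EFin \o g).
Proof.
move=> mD mg hi gh; apply/integrableP; split; first exact/measurable_EFinP.
have /integrableP[mh] := hi; apply: le_lt_trans.
apply: (ae_ge0_le_integral mD).
- by move=> t _; exact: abse_ge0.
- by apply: measurableT_comp => //; exact/measurable_EFinP.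
- by move=> t _; exact: abse_ge0.
- exact: measurableT_comp.
- by apply: filterS gh => t H Dt; rewrite /= lee_fin (le_trans (H Dt))// ler_norm.
Qed.

Lemma integrable_of_le (D : set R) (g : R -> R) (M : R) :
  lmeasurable_fun D g -> (forall t, D t -> 0 <= g t) ->
  (\int[mu]_(t in D) (g t)%:E <= M%:E)%E -> mu.-integrable D (EFin \o g).
Proof.
move=> mg g0 gM; apply/integrableP; split; first exact/measurable_EFinP.
apply: (le_lt_trans (y := M%:E)); last exact: ltry.
apply: le_trans gM; rewrite le_eqVlt; apply/orP; left; apply/eqP.
by apply: eq_integral => t; rewrite inE => Dt /=; rewrite ger0_norm// g0.
Qed.

Lemma young_product (a b p : R) : 1 < p -> 0 <= a -> 0 <= b ->
  a * b <= a `^ p + b `^ (p / (p - 1)).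
Proof.
move=> p1 a0 b0.
have p0 : 0 < p by lra.
have q1 : 0 < p - 1 by lra.
have q0 : 0 < p / (p - 1) by rewrite divr_gt0.
have pq : p^-1 + (p / (p - 1))^-1 = 1 by rewrite invfM invrK; field; rewrite !gt_eqF.
apply: (le_trans (conjugate_powR a0 b0 p0 q0 pq)); rewrite lerD//.
  by rewrite ler_pdivrMr// ler_peMr ?powR_ge0// ltW.
rewrite ler_pdivrMr// ler_peMr ?powR_ge0// ler_pdivlMr// mul1r; lra.
Qed.

Lemma le_1_powR (a p : R) : 1 <= p -> 0 <= a -> a <= 1 + a `^ p.
Proof.
move=> p1 a0; have [a1|/ltW a1] := leP a 1.
  by rewrite (le_trans a1)// lerDl powR_ge0.
by rewrite (le_trans (le1r_powR a1 p1))// lerDr.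
Qed.

(** For [1 < p] all three functions are dominated by [1 + nv^p + f^p'], the
    product by Young's inequality. For [p = 1] the hypothesis bounds [f] a.e.,
    and its instance at a single time bounds the integral of [nv]. *)
Lemma norms_integrable (T p N0 : R) (nv f : R -> R) : 0 < T -> 1 <= p ->
  lmeasurable_fun `[0, T]%classic nv -> lmeasurable_fun `[0, T]%classic f ->
  (forall t, 0 <= nv t) -> (forall t, 0 <= t <= T -> 0 <= f t) ->
  (1 < p -> (\int[mu]_(t in `[0%R, T]%classic)
      ((nv t) `^ p + (f t) `^ (p / (p - 1)))%:E <= N0%:E)%E) ->
  (p = 1 -> {ae mu, forall t, t \in `[0, T] ->
       (\int[mu]_(r in `[0%R, T]%classic) (nv r)%:E + (f t)%:E <= N0%:E)%E}) ->
  [/\ segintegrable nv 0 T, segintegrable f 0 T & segintegrable (fun t => nv t * f t) 0 T].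
Proof.
move=> T0 p1 mnv mf nv0 f0 Hp H1.
have mD := @lmeas_itv R `[0, T].
have mnvf : lmeasurable_fun `[0, T]%classic (fun t => nv t * f t) by exact: measurable_funM.
move: p1; rewrite le_eqVlt => /predU1P[p1|p1].
  have {}H1 := H1 (esym p1).
  pose I := (\int[mu]_(r in `[0%R, T]%classic) (nv r)%:E)%E.
  have I0 : (0 <= I)%E by apply: integral_ge0 => t _; rewrite lee_fin.
  have nvi : segintegrable nv 0 T.
    have [t [t0 tT Gt]] := @ae_dense R [set t | (I + (f t)%:E <= N0%:E)%E] 0 T 0 T
      H1 (lexx _) T0 (lexx _).
    apply: (@integrable_of_le _ _ (N0 - f t)) => //.
    by rewrite EFinB leeBrDr.
  have fN : {ae mu, forall t, `[0, T]%classic t -> `|f t| <= N0}.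
    apply: filterS H1 => t H tT.
    rewrite ger0_norm ?f0//.
    by rewrite -lee_fin; apply: le_trans (H tT); exact: leeDr.
  split => //.
    exact: (integrable_ae_le mD mf (segintegrable_cst N0 0 T) fN).
  apply: (integrable_ae_le mD mnvf (integrableZl mD N0 nvi)).
  apply: filterS fN => t H tT; rewrite /= normrM mulrC.
  by rewrite (ger0_norm (nv0 t)) ler_wpM2r// H.
have {}Hp := Hp p1.
pose g t := nv t `^ p + f t `^ (p / (p - 1)).
have q1 : 1 <= p / (p - 1) by clear -p1; rewrite ler_pdivlMr; lra.
have mg : lmeasurable_fun `[0, T]%classic g.
  apply: measurable_funD.
    exact: (@measurableT_comp _ _ _ _ _ _ (@powR R ^~ p)).
  exact: (@measurableT_comp _ _ _ _ _ _ (@powR R ^~ _)).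
have gi : segintegrable g 0 T.
  by apply: (@integrable_of_le _ _ N0) => // t _; rewrite addr_ge0 ?powR_ge0.
have gi1 : segintegrable (fun t => 1 + g t) 0 T.
  exact: (integrableD mD (segintegrable_cst 1 0 T) gi).
split.
- apply: (integrable_ae_le mD mnv gi1); apply/aeW => t tT.
  rewrite ger0_norm ?nv0// (le_trans (le_1_powR (ltW p1) (nv0 t)))// /g addrA lerDl powR_ge0//.
- apply: (integrable_ae_le mD mf gi1); apply/aeW => t tT.
  have ft0 : 0 <= f t by apply: f0; rewrite /= in_itv in tT.
  rewrite ger0_norm// (le_trans (le_1_powR q1 ft0))// /g addrCA lerDr powR_ge0//.
- apply: (integrable_ae_le mD mnvf gi); apply/aeW => t tT.
  have ft0 : 0 <= f t by apply: f0; rewrite /= in_itv in tT.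
  by rewrite ger0_norm ?mulr_ge0 ?nv0//; exact: young_product.
Qed.

End measurability_integrability.

(** * The continuous version and its energy equality *)

Section regularity.
Context {R : realType}.
Local Notation mu := (leb R).
Local Notation segint g a b := (\int[mu]_(x in `[a, b]%classic) g x).
Local Notation segintegrable g a b := (mu.-integrable `[a, b]%classic (EFin \o g)).
Local Notation lmeasurable_fun := (@measurable_fun _ _ (lebesgue_line R) R).

(** The countably many test vectors that replace a dense subset of [V]: each
    value of a strongly measurable function is a.e. in their closure. *)
Lemma simple_values_enum {V : normedModType R[i]} (s : nat -> {fimfun R >-> V}) :
  exists X : nat -> V, forall n t, exists m, s n t = X m.
Proof.
have fin n : exists l : seq V, range (s n) = [set` l].
  by apply/finite_seqP; exact: fimfunP.
pose L n := projT1 (cid (fin n)).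
have LE n : range (s n) = [set` L n] by rewrite /L; case: cid.
exists (fun m => let p := odflt (0, 0)%N (unpickle m) in nth 0 (L p.1) p.2) => n t.
have : [set` L n] (s n t) by rewrite -LE; exists t.
move=> /= stL; exists (pickle (n, index (s n t) (L n))).
by rewrite pickleK/= nth_index.
Qed.

Lemma continuous_modulus (g : R -> R) T t e : {within `[0, T]%classic, continuous g} ->
  0 <= t <= T -> 0 < e -> exists2 d : R, 0 < d &
    forall s, 0 <= s <= T -> `|s - t| < d -> `|g t - g s| < e.
Proof.
move=> /subspace_continuousP gc tT e0.
have /(@cvgrPdist_lt _ R^o) /(_ e e0) : g @ within `[0, T]%classic (nbhs t) --> g t.
  by apply: gc; rewrite /= in_itv.
rewrite near_withinE => /nbhs_ballP[d /= d0 H]; exists d => // s sT st.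
by apply: H; rewrite /ball/= ?in_itv// distrC.
Qed.

(** A set of full measure is dense in [[0, T]]; [good_point_near] is used with
    weight 1 to cover the end points as well. *)
Lemma ae_continuous_eq (g h : R -> R) T : 0 < T ->
  {within `[0, T]%classic, continuous g} -> {within `[0, T]%classic, continuous h} ->
  {ae mu, forall t, 0 <= t <= T -> g t = h t} ->
  forall t, 0 <= t <= T -> g t = h t.
Proof.
move=> T0 gc hc gh t tT; apply/eqP; rewrite -subr_eq0 -normr_le0.
apply/ler_addgt0Pr => e e0; have e20 : 0 < e / 2 by lra.
have [d1 d10 H1] := continuous_modulus gc tT e20.
have [d2 d20 H2] := continuous_modulus hc tT e20.
have d0 : 0 < Num.min d1 d2 by rewrite lt_min d10.
have [s [sT ghs + _]] := @good_point_near R [set t | g t = h t] (fun=> 1) (fun=> 0) T t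
  (Num.min d1 d2) 1 T0 tT gh (segintegrable_cst _ _ _) (segintegrable_cst _ _ _) (fun _ _ => lexx _)
  (fun=> lexx _) d0 ltr01.
rewrite lt_min => /andP[s1 s2].
have := H1 s sT s1; have := H2 s sT s2; rewrite /= in ghs; rewrite ghs.
rewrite (distrC (h t)) => A B; have := ler_normD (g t - h s) (h s - h t).
by rewrite subrKA add0r; move: A B; clear; lra.
Qed.

Lemma sqr_dist_expand (a b c : R) : (b - c) - (c - a) = (b - a) - 2 * (c - a).
Proof. ring. Qed.

Lemma energy_bound_aux (x r m : R) : `|r| <= m -> x - 2 * r <= `|x| + 2 * m.
Proof. by rewrite ler_norml => /andP[? ?]; have := ler_norm x; lra. Qed.

Context {V : normedModType R[i]} {H : completeNormedModType R[i]}.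
Variables (ip : {dot H for Num.conj}) (j : {linear V -> H}) (T : R).
Variables (v : R -> V) (vs : R -> dual V) (f : R -> R) (u0 : H).
Hypothesis ip_norm : forall x : H, `|x| ^+ 2 = ip x x.
Hypothesis j_norm : forall x : V, rnorm (j x) <= rnorm x.
Hypothesis j_dense : dense (range j).
Hypothesis T_gt0 : 0 < T.
Hypothesis v_meas : strongly_measurable `[0, T]%classic v.
Let q t x := complex.Re (vs t x).
Hypothesis q_meas : forall x, lmeasurable_fun `[0, T]%classic (fun t => q t x).
Hypothesis f_int : segintegrable f 0 T.
Hypothesis v_int : segintegrable (fun t => rnorm (v t)) 0 T.
Hypothesis vf_int : segintegrable (fun t => rnorm (v t) * f t) 0 T.
Hypothesis vs_le : forall t, 0 <= t <= T -> dual_norm (vs t) <= f t.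
Hypothesis v_eq : forall w, {ae mu, forall t, 0 <= t <= T ->
  rip ip (j (v t)) (j w) = rip ip u0 (j w) + segint (fun r => q r w) 0 t}.

Let k t := 1 + f t.

Let f_ge0 t : 0 <= t <= T -> 0 <= f t.
Proof. by move=> tT; rewrite (le_trans (dual_norm_ge0 (vs t)))// vs_le. Qed.

Let k_ge1 t : 0 <= t <= T -> 1 <= k t.
Proof. by move=> tT; rewrite lerDl f_ge0. Qed.

Let k_ge0 t : 0 <= t <= T -> 0 <= k t.
Proof. by move=> /k_ge1; exact: le_trans. Qed.

Let k_int : segintegrable k 0 T.
Proof. exact: (integrableD (lmeas_itv _) (segintegrable_cst 1 0 T) f_int). Qed.

Let vk_int : segintegrable (fun t => rnorm (v t) * k t) 0 T.
Proof.
rewrite (_ : (fun t => _) = (fun t => rnorm (v t) + rnorm (v t) * f t)).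
  exact: (integrableD (lmeas_itv _) v_int vf_int).
by apply/funext => t; rewrite mulrDr mulr1.
Qed.

Let norm_meas x : lmeasurable_fun `[0, T]%classic (fun t => rnorm (v t - x)).
Proof.
apply: (@lmeasurable_strongly_comp R V _ v (fun _ y => rnorm (y - x)) (fun=> 1)) => //.
move=> t _ y z; rewrite mul1r (le_trans (rnorm_dist _ _))//.
by rewrite opprB addrA subrK.
Qed.

Let vxk_int x : segintegrable (fun t => rnorm (v t - x) * k t) 0 T.
Proof.
have i2 : segintegrable (fun t => rnorm x * k t) 0 T.
  exact: (integrableZl (lmeas_itv _) (rnorm x) k_int).
apply: (segintegrable_le _ (integrableD (lmeas_itv _) vk_int i2)).
  by apply: measurable_funM => //; exact: segintegrable_measurable.
move=> t tT /=; have kt := k_ge0 tT.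
rewrite !ger0_norm ?addr_ge0 ?mulr_ge0 ?rnorm_ge0// -mulrDl ler_wpM2r//.
by rewrite (le_trans (rnormD _ _))// rnormN.
Qed.

Let q_le t x : 0 <= t <= T -> `|q t x| <= k t * rnorm x.
Proof.
move=> tT; apply: (le_trans (dual_Re_bound _ _)); rewrite ler_wpM2r ?rnorm_ge0//.
by rewrite (le_trans (vs_le tT))// lerDr.
Qed.

Let qB t x y : q t (x - y) = q t x - q t y.
Proof. exact: dual_ReB. Qed.

Let q_int x : segintegrable (fun t => q t x) 0 T.
Proof.
apply: (segintegrable_le (q_meas x) (integrableZl (lmeas_itv _) (rnorm x) k_int)).
move=> t tT /=; rewrite mulrC [leRHS]ger0_norm ?mulr_ge0 ?rnorm_ge0 ?k_ge0//.
exact: q_le.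
Qed.

Let qv_int : segintegrable (fun t => q t (v t)) 0 T.
Proof.
apply: (segintegrable_le _ vk_int).
  apply: (@lmeasurable_strongly_comp R V _ v q k) => //.
  by move=> t /=; rewrite in_itv/= => tT x y; rewrite -qB; exact: q_le.
move=> t tT /=; rewrite [leRHS]ger0_norm ?mulr_ge0 ?rnorm_ge0 ?k_ge0// mulrC.
exact: q_le.
Qed.

Lemma weak_increment s t : 0 <= s -> s <= t -> t <= T -> forall x : V,
  rip ip (j (v s)) (j x) = rip ip u0 (j x) + segint (fun r => q r x) 0 s ->
  rip ip (j (v t)) (j x) = rip ip u0 (j x) + segint (fun r => q r x) 0 t ->
  rip ip (j (v t) - j (v s)) (j x) = segint (fun r => q r x) s t.
Proof.
move=> s0 st tT x hs ht; rewrite ripBl hs ht.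
rewrite (segint_split s0 st (segintegrable_sub (q_int x) (lexx _) tT)); ring.
Qed.

Lemma continuous_energy_version : exists u : R -> H,
  [/\ {within `[0, T]%classic, continuous u},
      {ae mu, forall t, 0 <= t <= T -> u t = j (v t)},
      u 0 = u0,
      forall t, 0 <= t <= T -> forall w,
        rip ip (u t) (j w) = rip ip u0 (j w) + segint (fun r => q r w) 0 t &
      segintegrable (fun t => q t (v t)) 0 T /\
      forall t, 0 <= t <= T ->
        rnorm (u t) ^+ 2 = rnorm u0 ^+ 2 + 2 * segint (fun r => q r (v r)) 0 t].
Proof.
have [s _ sv] := v_meas.
have [X sX] := simple_values_enum s.
pose G := [set t | (forall h : R, 0 < h -> exists n, rnorm (v t - X n) < h) /\
  forall n, rip ip (j (v t)) (j (X n)) =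
            rip ip u0 (j (X n)) + segint (fun r => q r (X n)) 0 t].
have G_ae : {ae mu, forall t, 0 <= t <= T -> G t}.
  have A : {ae mu, forall t n, 0 <= t <= T -> rip ip (j (v t)) (j (X n)) =
            rip ip u0 (j (X n)) + segint (fun r => q r (X n)) 0 t}.
    by apply/ae_foralln => n; exact: v_eq.
  apply: filterS2 A sv => t At svt tT; split; last by move=> n; exact: At.
  move=> h h0; have /cvg_rnormP /(_ h h0) : s n t @[n --> \oo] --> v t.
    by apply: svt; rewrite /= in_itv.
  move=> [n _ /(_ n (leqnn _))]/= snt; have [m sm] := sX n t.
  by exists m; rewrite -sm.
(* The weak equation extends from the test vectors [X n] to their limits [v c],
   their difference being Lipschitz in the test vector with constant [C]. *)
have weak a b c : G a -> G b -> G c -> 0 <= a -> a <= b -> b <= T ->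
    rip ip (j (v b) - j (v a)) (j (v c)) = segint (fun r => q r (v c)) a b.
  move=> [_ Ga] [_ Gb] [Gc _] a0 ab bT.
  set A := j (v b) - j (v a).
  apply/eqP; rewrite -subr_eq0 -normr_le0; apply/ler_addgt0Pr => e e0; rewrite add0r.
  pose C := rnorm A + segint k a b.
  have C0 : 0 <= C.
    apply: addr_ge0; first exact: rnorm_ge0.
    apply: segint_ge0 => t /andP[at_ tb]; apply: k_ge0.
    by rewrite (le_trans a0 at_) (le_trans tb bT).
  have [|n Hn] := Gc (e / (C + 1)); first by rewrite divr_gt0// ltr_wpDl.
  have E := weak_increment a0 ab bT (Ga n) (Gb n).
  have -> : rip ip A (j (v c)) - segint (fun r => q r (v c)) a b =
      rip ip A (j (v c - X n)) - segint (fun r => q r (v c - X n)) a b.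
    by rewrite linearB ripBr E -(segint_pairingB q_int qB)// opprB addrA subrK.
  have h1 := rip_le ip_norm A (j (v c - X n)).
  have h2 := segint_pairing_le k_int q_int q_le (v c - X n) a0 bT.
  have h3 : rnorm A * rnorm (j (v c - X n)) <= rnorm A * rnorm (v c - X n).
    by rewrite ler_wpM2l ?rnorm_ge0.
  apply: (le_trans (ler_normB _ _)); apply: (le_trans (lerD (le_trans h1 h3) h2)).
  rewrite -mulrDl -/C; move: Hn; rewrite ltr_pdivlMr ?ltr_wpDl// => /ltW.
  apply: le_trans; rewrite mulrC ler_wpM2l ?rnorm_ge0// lerDl//.
pose phi t := rnorm (j (v t)) ^+ 2.
have phiE a b : G a -> G b -> 0 <= a -> a <= b -> b <= T ->
    phi b - phi a = segint (fun r => q r (v b)) a b + segint (fun r => q r (v a)) a b.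
  move=> Ga Gb a0 ab bT; rewrite -(weak a b b)// -(weak a b a)//.
  rewrite /phi -!(ripxx ip_norm) !ripBl (ripC ip (j (v b)) (j (v a))).
  by rewrite addrA subrK.
have phi_inc a b : G a -> G b -> 0 <= a -> a <= b -> b <= T ->
    phi b - phi a = 2 * segint (fun r => q r (v r)) a b.
  apply: (energy_increment (k := k) (X := X)) => //.
  by move=> t [].
pose Q r := 2 * q r (v r).
have Q_int : segintegrable Q 0 T by exact: (integrableZl (lmeas_itv _) 2 qv_int).
have QE t : 0 <= t <= T -> segint Q 0 t = 2 * segint (fun r => q r (v r)) 0 t.
  move=> /andP[t0 tT]; apply: RintegralZl; first exact: lmeas_itv.
  exact: segintegrable_sub qv_int (lexx _) tT.
have phiQ a b : G a -> G b -> 0 <= a <= T -> 0 <= b <= T ->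
    phi b - phi a = segint Q 0 b - segint Q 0 a.
  wlog ab : a b / a <= b.
    move=> W; have [/W|/ltW/W] := leP a b; first exact.
    by move=> WW Ga Gb aT bT; rewrite -[LHS]opprB -[RHS]opprB WW.
  move=> Ga Gb aT bT; have /andP[a0 _] := aT; have /andP[_ bT'] := bT.
  rewrite phi_inc// !QE// (segint_split a0 ab (segintegrable_sub qv_int (lexx _) bT')).
  by rewrite mulrDr addrAC subrr add0r.
have [u uc uG] : exists2 u : R -> H, {within `[0, T]%classic, continuous u} &
    forall t, 0 <= t <= T -> G t -> u t = j (v t).
  apply: (@cauchy_of_energy R H (fun t => j (v t)) G k (fun t => rnorm (v t)) Q T) => //.
    by move=> t; exact: rnorm_ge0.
  move=> a b Ga Gb aT bT; rewrite -phiQ//.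
  have E : rnorm (j (v b) - j (v a)) ^+ 2 =
      (phi b - phi a) - 2 * rip ip (j (v b) - j (v a)) (j (v a)).
    rewrite /phi -!(ripxx ip_norm) !ripBl !ripBr (ripC ip (j (v a)) (j (v b))).
    exact: sqr_dist_expand.
  have B : `|rip ip (j (v b) - j (v a)) (j (v a))| <=
      `|segint k 0 b - segint k 0 a| * rnorm (v a).
    have inc x y : 0 <= x -> x <= y -> y <= T -> segint k 0 y - segint k 0 x = segint k x y.
      move=> x0 xy yT; rewrite (segint_split x0 xy (segintegrable_sub k_int (lexx _) yT)).
      by rewrite addrAC subrr add0r.
    have /andP[a0 aT'] := aT; have /andP[b0 bT'] := bT.
    have [ab|/ltW ba] := leP a b.
      rewrite weak// inc//.
      apply: (le_trans (segint_pairing_le k_int q_int q_le (v a) a0 bT')).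
      by rewrite ler_wpM2r ?rnorm_ge0// ler_norm.
    rewrite (ripBl _ (j (v b))) -[X in `|X|]opprB -(ripBl _ (j (v a))) normrN.
    rewrite weak// (distrC (segint k 0 b)) inc//.
    apply: (le_trans (segint_pairing_le k_int q_int q_le (v a) b0 aT')).
    by rewrite ler_wpM2r ?rnorm_ge0// ler_norm.
  by rewrite E; exact: energy_bound_aux.
(* From here on all identities on [G] extend to [[0, T]] by continuity. *)
have u_ae : {ae mu, forall t, 0 <= t <= T -> u t = j (v t)}.
  by apply: filterS G_ae => t Gt tT; apply: uG => //; exact: Gt.
have rip_cont x : {within `[0, T]%classic, continuous (fun t => rip ip (u t) x)}.
  apply/subspace_continuousP => t tT; apply/(@cvgrPdist_lt _ R^o) => e e0.
  move/subspace_continuousP : uc => /(_ t tT)/cvg_rnormP.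
  have x1 : 0 < rnorm x + 1 by rewrite ltr_wpDl ?rnorm_ge0.
  have ex : 0 < e / (rnorm x + 1) by rewrite divr_gt0.
  move=> /(_ _ ex); apply: filterS => r; rewrite ltr_pdivlMr// => ur.
  rewrite -ripBl; apply: (le_lt_trans (rip_le ip_norm _ _)); apply: le_lt_trans ur.
  by rewrite ler_wpM2l ?rnorm_ge0// lerDl.
have norm_cont : {within `[0, T]%classic, continuous (fun t => rnorm (u t))}.
  apply/subspace_continuousP => t tT; apply/(@cvgrPdist_lt _ R^o) => e e0.
  move/subspace_continuousP : uc => /(_ t tT)/cvg_rnormP /(_ _ e0).
  by apply: filterS => r; apply: le_lt_trans; exact: rnorm_dist.
have T0 : 0 <= (0 : R) <= T by rewrite !lexx/= ltW.
have weak_u t w : 0 <= t <= T ->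
    rip ip (u t) (j w) = rip ip u0 (j w) + segint (fun r => q r w) 0 t.
  move: t; apply: ae_continuous_eq => //.
    apply: within_continuousD; first by move=> ?; exact: cvg_cst.
    exact: segint_continuous.
  by apply: filterS2 u_ae (v_eq w) => t ut vt tT; rewrite ut// vt.
have u00 : u 0 = u0.
  apply/eqP; rewrite -subr_eq0; apply/eqP/rnorm0_eq0.
  set x := u 0 - u0.
  have orth w : rip ip x (j w) = 0.
    by rewrite /x ripBl weak_u// segint_point addr0 subrr.
  clearbody x.
  apply/eqP; rewrite eq_le rnorm_ge0 andbT; apply/ler_addgt0Pr => e e0; rewrite add0r.
  have e0' : 0 < e%:C by rewrite ltcR.
  have [|y [xy [w _ wy]]] := @j_dense (ball x e%:C) _ (ball_open _ _).
    by exists x; exact: ballxx.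
  move: xy; rewrite -ball_normE/= rnormE ltcR -wy => xw.
  have [->|x0] := eqVneq (rnorm x) 0; first exact: ltW.
  have xp : 0 < rnorm x by rewrite lt_neqAle eq_sym x0 rnorm_ge0.
  rewrite -(ler_pM2l xp) -expr2 -(ripxx ip_norm).
  have -> : rip ip x x = rip ip x (x - j w) by rewrite ripBr orth subr0.
  apply: (le_trans (ler_norm _)); apply: (le_trans (rip_le ip_norm _ _)).
  by rewrite ler_pM2l// ltW.
exists u; split => //; first by move=> t tT w; exact: weak_u.
split => // t tT.
have [a [a0 aT Ga]] := ae_dense G_ae (lexx _) T_gt0 (lexx _).
have aI : 0 <= a <= T by rewrite !ltW.
have EE : forall t, 0 <= t <= T -> rnorm (u t) ^+ 2 = segint Q 0 t + (phi a - segint Q 0 a).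
  apply: ae_continuous_eq => //.
  - move=> x; rewrite (_ : (fun t => _) = (fun t => rnorm (u t) * rnorm (u t))) //.
    by apply: cvgM; exact: norm_cont.
  - apply: within_continuousD; last by move=> ?; exact: cvg_cst.
    exact: segint_continuous.
  - apply: filterS G_ae => b Gb bT.
    rewrite (uG b)//; last exact: Gb.
    rewrite -/(phi b) addrCA -(phiQ a b)//; last exact: Gb.
    by rewrite addrC subrK.
have := EE 0 T0; rewrite u00 segint_point add0r => ->.
by rewrite (EE t tT) QE// addrC.
Qed.
End regularity.

(** * From real parts to the complex statement *)

Section complex_statement.
Context {R : realType}.
Local Notation mu := (leb R).
Local Notation segint g a b := (\int[mu]_(x in `[a, b]%classic) g x).
Local Notation segintegrable g a b := (mu.-integrable `[a, b]%classic (EFin \o g)).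

(** If [P] holds off [N], then [Q] holds off the union of [N * R] and [R * N]. *)
Lemma ae_prod (P : R -> Prop) (Q : R * R -> Prop) :
  {ae mu, forall t, P t} -> (forall st, P st.1 -> P st.2 -> Q st) ->
  {ae (mu \x mu)%E, forall st, Q st}.
Proof.
move=> [N [mN N0 HN]] PQ.
exists (N `*` setT `|` setT `*` N); split.
- by apply: measurableU; apply: measurableX.
- apply/eqP; rewrite -measure_le0.
  apply: le_trans (measureU2 _ _ _) _; [exact: measurableX..|].
  have e1 : (mu \x mu)%E (N `*` setT) = 0%E.
    by exact: etrans (product_measure1E _ _ mN measurableT)
      (etrans (congr1 (mule^~ _) N0) (mul0e _)).
  have e2 : (mu \x mu)%E (setT `*` N) = 0%E.
    by exact: etrans (product_measure1E _ _ measurableT mN)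
      (etrans (congr1 (mule _) N0) (mule0 _)).
  by rewrite -[leRHS]adde0; apply: leeD; rewrite le_eqVlt; apply/orP; left; apply/eqP.
- move=> [s t] /= nQ; have [Ps|nPs] := pselect (P s); last by left; split => //; exact: HN.
  have [Pt|nPt] := pselect (P t); last by right; split => //; exact: HN.
  by exfalso; apply: nQ; exact: PQ.
Qed.

Lemma cintegral_ge a b (g : R -> R[i]) : a <= b -> cintegral a b g =
  (segint (fun r => complex.Re (g r)) a b) +i* (segint (fun r => complex.Im (g r)) a b).
Proof. by rewrite /cintegral => ->. Qed.

Lemma cintegral_diff T (g : R -> R[i]) s t :
  segintegrable (fun r => complex.Re (g r)) 0 T -> segintegrable (fun r => complex.Im (g r)) 0 T ->
  0 <= s <= T -> 0 <= t <= T ->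
  cintegral 0 t g - cintegral 0 s g = cintegral s t g.
Proof.
move=> ri ii.
have main a b : 0 <= a <= T -> 0 <= b <= T -> a <= b ->
    cintegral 0 b g - cintegral 0 a g = cintegral a b g.
  move=> /andP[a0 aT] /andP[b0 bT] ab; rewrite !cintegral_ge//.
  rewrite (segint_split a0 ab (segintegrable_sub ri (lexx _) bT)).
  rewrite (segint_split a0 ab (segintegrable_sub ii (lexx _) bT)).
  by apply/eqP; rewrite eq_complex/=; apply/andP; split; rewrite addrAC subrr add0r.
move=> sT tT; have [st|ts] := leP s t; first exact: main.
have := main t s tT sT (ltW ts); rewrite (cintegral_ge g (ltW ts)) => E.
by rewrite /cintegral (leNgt s t) ts/= -E opprB.
Qed.

Lemma pairing_inE {V H : normedModType R[i]} (j : {linear V -> H}) (f : dual V) x :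
  injective j -> pairing_in j f (j x) = f x.
Proof.
move=> j_inj; rewrite /pairing_in; congr (f _).
by apply: pinvKV; rewrite ?inE// => y z _ _; exact: j_inj.
Qed.
End complex_statement.

Unset Implicit Arguments.
Theorem corollary1p5 (R : realType)
  (V : completeNormedModType R[i])
  (H : completeNormedModType R[i]) (ip : {dot H for Num.conj})
  (ip_norm : forall x : H, `|x| ^+ 2 = ip x x)
  (j : {linear V -> H}) (j_inj : injective j)
  (j_norm : forall v : V, rnorm (j v) <= rnorm v)
  (T : R) (T_gt0 : 0 < T) (p : R) (p_ge1 : 1 <= p)
  (v : R -> V) (v_meas : strongly_measurable `[0, T]%classic v)
  (vs : R -> dual V)
  (vs_meas : forall w : V, clebesgue_measurable `[0, T]%classic (fun t => vs t w))
  (f : R -> R) (f_meas : lebesgue_measurable `[0, T]%classic f)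
  (vs_le_f : forall t, t \in `[0, T] -> dual_norm (vs t) <= f t)
  (N0 : R) (N0_ge1 : 1 <= N0)
  (bound_gt1 : 1 < p ->
     (\int[leb R]_(t in `[0%R, T])
        ((rnorm (v t)) `^ p + (f t) `^ (p / (p - 1)))%:E <= N0%:E)%E)
  (bound_eq1 : p = 1 ->
     {ae leb R, forall t, t \in `[0, T] ->
       (\int[leb R]_(r in `[0%R, T]) (rnorm (v r))%:E + (f t)%:E <= N0%:E)%E})
  (V_dense : dense (range j))
  (u0 : H)
  (v_eq : forall w : V, {ae leb R, forall t, t \in `[0, T] ->
     ip (j (v t)) (j w) = ip u0 (j w) + cintegral 0 t (fun r => vs r w)}) :
  (forall w : V,
     {ae (leb R \x leb R)%E, forall st,
       st.1 \in `[0, T] -> st.2 \in `[0, T] ->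
       ip (j (v st.2)) (j w) - ip (j (v st.1)) (j w) =
       cintegral st.1 st.2 (fun r => vs r w)}) /\
  exists u : R -> H,
    [/\ {within `[0, T], continuous u},
        {ae leb R, forall t, t \in `[0, T] -> u t = j (v t)},
        u 0 = u0,
        (forall t, t \in `[0, T] -> forall w : V,
           ip (u t) (j w) = ip (u 0) (j w) + cintegral 0 t (fun r => vs r w)) &
        (leb R).-integrable `[0, T]%classic
          (fun s => (complex.Re (pairing_in j (vs s) (u s)))%:E) /\
        (forall t, t \in `[0, T] ->
           rnorm (u t) ^+ 2 = rnorm (u 0) ^+ 2 +
             2 * \int[leb R]_(s in `[0, t])
                   complex.Re (pairing_in j (vs s) (u s)))].
Proof.
have inT (t : R) : (t \in `[0, T]) = (0 <= t <= T) by rewrite in_itv.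
have T0 : 0 <= (0 : R) <= T by rewrite lexx/= ltW.
have vs_le t : 0 <= t <= T -> dual_norm (vs t) <= f t by rewrite -inT; exact: vs_le_f.
have f0 t : 0 <= t <= T -> 0 <= f t.
  by move=> /vs_le; apply: le_trans; exact: dual_norm_ge0.
have mnv : @measurable_fun _ _ (lebesgue_line R) R `[0, T]%classic (fun t => rnorm (v t)).
  apply: (@lmeasurable_strongly_comp R V _ v (fun _ y => rnorm y) (fun=> 1)) => //.
  by move=> t _ x y; rewrite mul1r; exact: rnorm_dist.
have [vi fi vfi] := norms_integrable T_gt0 p_ge1 mnv f_meas (fun t => rnorm_ge0 (v t))
  f0 bound_gt1 bound_eq1.
have Im_q t x : complex.Im (vs t x) = complex.Re (vs t ('i *: x)) by exact: dual_Im.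
have re_int w : (leb R).-integrable `[0, T]%classic
    (EFin \o (fun r => complex.Re (vs r w))).
  apply: (segintegrable_le (vs_meas w).1 (integrableZl (lmeas_itv _) (rnorm w) fi)).
  move=> t tT /=; rewrite mulrC [leRHS]ger0_norm ?mulr_ge0 ?rnorm_ge0 ?f0//.
  by rewrite (le_trans (dual_Re_bound _ _))// ler_wpM2r ?rnorm_ge0 ?vs_le.
have im_int w : (leb R).-integrable `[0, T]%classic
    (EFin \o (fun r => complex.Im (vs r w))).
  rewrite (_ : (fun r => _) = (fun r => complex.Re (vs r ('i *: w)))) //.
  by apply/funext => r; exact: Im_q.
split.
  move=> w; apply: ae_prod (v_eq w) _ => -[s t] /= hs ht sT tT.
  rewrite hs// ht// opprD addrACA subrr add0r (cintegral_diff (re_int w) (im_int w)) -?inT//.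
have v_eq' w : {ae leb R, forall t, 0 <= t <= T ->
    rip ip (j (v t)) (j w) = rip ip u0 (j w) +
      \int[leb R]_(r in `[0, t]%classic) complex.Re (vs r w)}.
  apply: filterS (v_eq w) => t Ht tT; rewrite /rip Ht ?inT//.
  by rewrite ReD cintegral_ge//; case/andP: tT.
have [u [uc u_ae u00 uw [qvi ue]]] := continuous_energy_version ip_norm j_norm V_dense
  T_gt0 v_meas (fun x => (vs_meas x).1) fi vi vfi vs_le v_eq'.
have pair_ae : {ae leb R, forall t, `[0, T]%classic t ->
    complex.Re (vs t (v t)) = complex.Re (pairing_in j (vs t) (u t))}.
  apply: filterS u_ae => t Ht; rewrite /= inT => tT.
  by rewrite Ht// pairing_inE.
have mqv := segintegrable_measurable qvi.
have mpair := lmeasurable_ae mqv pair_ae.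
have pair_int : (leb R).-integrable `[0, T]%classic
    (EFin \o (fun s => complex.Re (pairing_in j (vs s) (u s)))).
  apply: (integrable_ae_le (lmeas_itv _) mpair (integrable_norm qvi)).
  by apply: filterS pair_ae => t Ht tT /=; rewrite Ht.
exists u; split.
- exact: uc.
- by apply: filterS u_ae => t Ht; rewrite inT; exact: Ht.
- exact: u00.
- move=> t tT w; rewrite u00; have tT' : 0 <= t <= T by rewrite -inT.
  have t0 : 0 <= t by case/andP: tT'.
  apply/eqP; rewrite eq_complex; apply/andP; split; apply/eqP.
    by rewrite ReD cintegral_ge//; exact: uw.
  (* The imaginary part of the equation for [w] is the real part of the one for
     ['i *: w]. *)
  have ImD (a b : R[i]) : complex.Im (a + b) = complex.Im a + complex.Im b.
    by case: a b => [? ?] [? ?].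
  rewrite ImD cintegral_ge//= !ip_Im -linearZ/= uw//; congr (_ + _).
  by apply: eq_Rintegral => r _; rewrite -Im_q.
- split; first exact: pair_int.
  move=> t; rewrite inT => tT; rewrite ue// u00; congr (_ + 2 * _).
  have /andP[t0 tT'] := tT.
  congr fine; apply: ae_eq_integral.
  + exact: lmeas_itv.
  + exact: (measurable_int (leb R) (segintegrable_sub qvi (lexx _) tT')).
  + exact: (measurable_int (leb R) (segintegrable_sub pair_int (lexx _) tT')).
  + apply: filterS pair_ae => r Hr /= rt; rewrite Hr//.
    by apply: (subset_segment (lexx _) tT').
Qed.
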